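(* Consider the multistage stochastic linear program and Algorithm 2 described in the context. Assume that the process $(\xi_t)$ is interstage independent with $\xi_1$ deterministic and $\xi_t$ having finite support $\{\xi_{t,1},\dots,\xi_{t,M}\}$ for $t=2,\dots,T$. Assume that the sampling satisfies: for all $t=2,\dots,T$, $j=1,\dots,M$, $k\ge1$, $\mathbb{P}(\xi_t^k=\xi_{t,j})=\Phi_{t,j}>0$ with $\sum_{j=1}^M\Phi_{t,j}=1$, and $\xi_t^k$ is independent of $\sigma(\xi_2^1,\dots,\xi_T^1,\dots,\xi_2^{k-1},\dots,\xi_T^{k-1},\xi_2^k,\dots,\xi_{t-1}^k)$. Assume moreover that for every $t=1,\dots,T$, for every realization $(\tilde\xi_1,\dots,\tilde\xi_t)$ of $(\xi_1,\dots,\xi_t)$, and for every sequence of feasible decisions $x_{0:t-1}$ on that scenario, i.e. satisfying $x_\tau\in X_\tau(x_{0:\tau-1},\tilde\xi_\tau)$ for $\tau=1,\dots,t-1$, the set $X_t(x_{0:t-1},\tilde\xi_t)$ is bounded and nonempty. Then either Algorithm 2 terminates reporting that the problem is infeasible, or the following hold: (i) for $t=2,\dots,T$, almost surely, for all $n\in\mathtt{Nodes}(t-1)$, $$\lim_{k\to+\infty,\ k\in\tilde{\mathcal{S}}_n}\mathcal{Q}_t(x_{[n]}^k)-\mathcal{Q}_t^k(x_{[n]}^k)=0,$$ where $\tilde{\mathcal{S}}_n$ is the set of iterations $k$ at which the sampled scenario passes through the parent node of $n$; (ii) almost surely, $\lim_{k\to+\infty}\mathfrak{Q}_1^k(x_0,\xi_1)=\mathcal{Q}_1(x_0)$,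 and any accumulation point of the sequence $(x_1^k)_{k\in\mathbb{N}^*}$ of first stage decisions ($x_1^k=x_{n_1}^k$) is an optimal solution of the first stage problem $\inf\{\Psi_1^\top x_1+\mathcal{Q}_2(x_1):x_1\in X_1(x_0,\xi_1)\}$.
   Context: Problem: $T$ is the number of stages, $d$ the dimension of each decision, $x_0$ is given, $x_{s:t}=(x_s,\dots,x_t)$ (also viewed as a concatenated vector). $\xi_t$ is the concatenation of random vectors $\Psi_t\in\mathbb{R}^{dt}$, $b_t$ and random matrices $A_{t,\tau}$, $\tau=0,\dots,t$; $\Phi_{t,j}=\mathbb{P}(\xi_t=\xi_{t,j})>0$. Feasible sets: $X_t(x_{0:t-1},\xi_t)=\{x_t\in\mathbb{R}^d: x_t\ge0,\ \sum_{\tau=0}^tA_{t,\tau}x_\tau=b_t\}$. For $t=2,\dots,T$, $\rho_t$ is a coherent law invariant risk measure with dual representation $\rho_t(Z(\xi_t))=\sup_{p\in\mathcal{P}_t}\sum_{j=1}^Mp_j\Phi_{t,j}Z(\xi_{t,j})$, $\mathcal{P}_t$ a convex subset of $\{p\in\mathbb{R}^M:p\ge0,\sum_jp_j\Phi_{t,j}=1\}$. Recourse functions: $\mathcal{Q}_{T+1}\equiv0$ and for $t=T,\dots,2$, $\mathcal{Q}_t(x_{1:t-1})=\rho_t(\mathfrak{Q}_t(x_{1:t-1},\xi_t))$ with $\mathfrak{Q}_t(x_{1:t-1},\xi_t)=\inf\{\Psi_t^\top x_{1:t}+\mathcal{Q}_{t+1}(x_{1:t}):x_t\in X_t(x_{0:t-1},\xi_t)\}$.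 $\mathcal{Q}_1(x_0)=\mathfrak{Q}_1(x_0,\xi_1)$ is the optimal value of the first stage problem. Scenario tree: the root $n_0$ (stage 0, decision $x_0$) has one child $n_1$ (stage 1, $\xi_{n_1}=\xi_1$); every node of stage $t-1$, $2\le t\le T$, has $M$ children, one for each possible value of $\xi_t$. $\mathtt{Nodes}(t)$: nodes of stage $t$; $C(n)$: children of $n$; $\mathcal{P}(n)$: parent of $n$. If node $m$ of stage $t$ corresponds to $\xi_{t,j}$, then $\xi_m=\xi_{t,j}$, $\Psi_m,b_m,A_{\tau,m}$ are the corresponding components, $\Phi_m=\Phi_{t,j}$, and $p_m=p_j$ for $p\in\mathcal{P}_t$. For a node $n$ of stage $t$, $x_{[n]}$ is the history of decisions from $n_1$ to $n$ ($i$-th component $x_{\mathcal{P}^{t-i}(n)}$). Optimality cuts: $\mathcal{Q}_t^k(x_{1:t-1})=\max_{0\le\ell\le k}\big(\theta_t^\ell+\langle\beta_t^\ell,x_{1:t-1}-x^\ell_{[n_{t-1}^\ell]}\rangle\big)$. Feasibility cuts: at stage $t$, $K_t$ inequalities $x_{1:t}^\top\tilde\beta_{t+1}^\ell\le\tilde\theta_{t+1}^\ell$, $\ell=1,\dots,K_t$. Subscripts 1 and 2 on $\beta_{t+1}^\ell$ (resp. $\tilde\beta_{t+1}^\ell$) denote its first $d(t-1)$ and its last $d$ components. Phase I problem for $m\in C(n)$, $n$ of stage $t-1$ (with $e$ the vector of ones): $$\min_{x_t,y_1,y_2\ge0}\ e^\top(y_1+y_2)\ \text{ s.t. }\ A_{t,m}x_t+y_1-y_2=b_m-\sum_{\tau=0}^{t-1}A_{\tau,m}x^k_{\mathcal{P}^{t-\tau}(m)},\quad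 (x_{[n]}^k)^\top\tilde\beta_{t+1,1}^\ell+x_t^\top\tilde\beta_{t+1,2}^\ell\le\tilde\theta_{t+1}^\ell,\ \ell=1,\dots,K_t,$$ with optimal value $\tilde{\mathfrak{Q}}_t(x_{[n]}^k,\xi_m)$ and optimal multipliers $\pi,\tilde\pi$ for the two groups of constraints; $s=[A_{1,m}^\top;\dots;A_{t-1,m}^\top]\pi+[\tilde\beta_{t+1,1}^1,\dots,\tilde\beta_{t+1,1}^{K_t}]\tilde\pi$ is a subgradient of $\tilde{\mathfrak{Q}}_t(\cdot,\xi_m)$ at $x_{[n]}^k$. The associated feasibility cut for $x_{1:t-1}$ is $x_{1:t-1}^\top\tilde\beta_t^\ell\le\tilde\theta_t^\ell$ with $\tilde\beta_t^\ell=s$, $\tilde\theta_t^\ell=-\tilde{\mathfrak{Q}}_t(x_{[n]}^k,\xi_m)+s^\top x_{[n]}^k$. Stage problem for $m\in C(n)$ at iteration $k$: $$\inf_{x_t\ge0,\,z}\ [x_{[n]}^k;x_t]^\top\Psi_m+z\quad( ** )$$ subject to $\sum_{\tau=0}^{t-1}A_{\tau,m}x^k_{\mathcal{P}^{t-\tau}(m)}+A_{t,m}x_t=b_m$; $z\ge\theta_{t+1}^\ell+\langle\beta_{t+1,1}^\ell,x_{[n]}^k-x^\ell_{[n_{t-1}^\ell]}\rangle+\langle\beta_{t+1,2}^\ell,x_t-x^\ell_{n_t^\ell}\rangle$, $0\le\ell\le k-1$; $[x_{[n]}^k;x_t]^\top\tilde\beta_{t+1}^\ell\le\tilde\theta_{t+1}^\ell$,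 $\ell=1,\dots,K_t$; with optimal value $\mathfrak{Q}_t^{k-1}(x_{[n]}^k,\xi_m)$ ($\mathfrak{Q}_1^{k-1}(x_0,\xi_1)$ for $t=1$) and optimal multipliers $\pi_{k,m,1},\pi_{k,m,2},\pi_{k,m,3}$ for these three groups. Algorithm 2. Initialization: $k=1$, $K_t=0$ for all $t$, $\theta_t^0=-\infty$, $\beta_t^0=0$ ($\mathcal{Q}_t^0\equiv-\infty$) for $t=2,\dots,T$, $\theta_{T+1}^0=0$, $\beta_{T+1}^0=0$ ($\mathcal{Q}_{T+1}^0\equiv0$). Iteration $k$: sample nodes $(n_0^k,\dots,n_T^k)$ with $n_0^k=n_0$, $n_1^k=n_1$, $n_t^k\in C(n_{t-1}^k)$, corresponding to a realization of random variables $(\xi_1^k,\dots,\xi_T^k)$. Forward pass: start with $t=1$, $n=n_0$. While $t\le T$: with $n=n_{t-1}^k$, visit the children $m$ of $n$ one after another and solve the Phase I problem for $m$. If for some $m$ its optimal value is positive: if $t=1$, stop and report that the problem is infeasible; otherwise add the corresponding feasibility cut for $x_{1:t-1}$, increase $K_{t-1}$ by one, set $n=n_{t-2}^k$ and decrease $t$ by one. If all optimal values are zero, compute an optimal solution $x_m^k$ of $( ** )$ for $m=n_t^k$, and increase $t$ by one. Then, for $t=2,\dots,T$ and $n=n_{t-1}^k$: for each $m\in C(n)$, $m\ne n_t^k$, compute an optimal solution $x_m^k$ and the optimal value of $( ** )$; for each $m\in C(n)$ compute $$\pi_{k,m}=\Psi_m(1:d(t-1))+[A_{1,m}^\top;\dots;A_{t-1,m}^\top]\pi_{k,m,1}+[\beta_{t+1,1}^0,\dots,\beta_{t+1,1}^{k-1}]\pi_{k,m,2}+[\tilde\beta_{t+1,1}^1,\dots,\tilde\beta_{t+1,1}^{K_t}]\pi_{k,m,3}$$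 (a subgradient of $\mathfrak{Q}_t^{k-1}(\cdot,\xi_m)$ at $x_{[n]}^k$), where $\Psi_m(1:d(t-1))$ denotes the first $d(t-1)$ components of $\Psi_m$; let $(p_{k,m})_{m\in C(n)}\in\mathcal{P}_t$ attain $\sup_{p\in\mathcal{P}_t}\sum_{m\in C(n)}p_m\Phi_m\mathfrak{Q}_t^{k-1}(x_{[n]}^k,\xi_m)$; set $\theta_t^k=\sum_{m\in C(n)}p_{k,m}\Phi_m\mathfrak{Q}_t^{k-1}(x_{[n]}^k,\xi_m)$ and $\beta_t^k=\sum_{m\in C(n)}p_{k,m}\Phi_m\pi_{k,m}$. Set $\theta_{T+1}^k=0$, $\beta_{T+1}^k=0$, increase $k$ by one and go to the next iteration. Convention: as long as $\mathcal{Q}_{t+1}^{k-1}\equiv-\infty$, $( ** )$ has value $-\infty$, $x_m^k$ is any feasible point, $\theta_t^k=-\infty$ and the corresponding cut is $-\infty$. The solutions of the subproblems are computed from the data of the subproblem only (the cuts available when it is solved), not from the remaining part of the sample of iteration $k$. *)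

(* Defs.v *)
From HB Require Import structures.
From mathcomp Require Import all_boot all_order all_algebra.
From mathcomp Require Import all_classical all_reals all_analysis.

Set Implicit Arguments.
Unset Strict Implicit.
Unset Printing Implicit Defensive.

Import Order.TTheory GRing.Theory Num.Theory.
Import numFieldNormedType.Exports.

Local Open Scope classical_set_scope.
Local Open Scope ring_scope.

(* The decisions x_{0:t-1} = (x_0, ..., x_{t-1}) are a sequence of
   size t, so [rcons h x] is (x_{0:t-1}, x_t) and the stage t to be solved from
   a history h is [size h].  A concatenated vector v in R^{dt}, paired with
   x_{1:t}, is the family of its d-dimensional blocks, block i (1 <= i <= t)
   being [v i]; its first d(t-1) and last d components are the blocks
   1, ..., t-1 and the block t. *)

Definition hist (R : realType) (d : nat) := seq 'cV[R]_d.

Definition dotv (R : realType) (n : nat) (u v : 'cV[R]_n) : R :=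
  \sum_i u i 0 * v i 0.

Definition nonneg (R : realType) (n : nat) (x : 'cV[R]_n) : Prop :=
  forall i, 0 <= x i 0.

(* <v, x_{1:t}> for h = x_{0:t}; x_0 is not paired. *)
Definition hdot (R : realType) (d : nat) (v : nat -> 'cV[R]_d) (h : hist R d) :
    R :=
  \sum_(1 <= i < size h) dotv (v i) h`_i.

(* A value of xi_t: [cost i] is the i-th block of Psi_t, [rhs] is b_t and
   [tech tau] is A_{t,tau}. *)
Record stage_data (R : realType) (d : nat) := StageData {
  nrows : nat;
  cost : nat -> 'cV[R]_d;
  rhs : 'cV[R]_nrows;
  tech : nat -> 'M[R]_(nrows, d) }.

(* [supp t j] is xi_{t,j} and [dens t] is the set P_t of the dual
   representation of the risk measure [rho t]; all three families and [Phi]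
   are relevant for 2 <= t <= T only.  Risk measures act on functions of the
   index j of xi_{t,j}; extended real values are allowed because the recourse
   functions are infinite at infeasible histories. *)
Record mslp (R : realType) (d M : nat) := MSLP {
  horizon : nat;
  x0 : 'cV[R]_d;
  xi1 : stage_data R d;
  supp : nat -> 'I_M -> stage_data R d;
  Phi : nat -> 'I_M -> R;
  rho : nat -> ('I_M -> \bar R) -> \bar R;
  dens : nat -> set 'rV[R]_M }.

Section Problem.
Context (R : realType) (d M : nat).
Implicit Types (h : hist R d) (xi : stage_data R d) (x : 'cV[R]_d).

(* A_{t,0} x_0 + ... + A_{t,t} x_t - b_t for t = size h, h = x_{0:t-1}. *)
Definition residual h xi x : 'cV[R]_(nrows xi) :=
  \sum_(0 <= tau < size h) (tech xi tau *m h`_tau)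
  + tech xi (size h) *m x - rhs xi.

Definition feasible h xi : set 'cV[R]_d :=
  [set x | nonneg x /\ residual h xi x = 0].

Definition stage_value (V : hist R d -> \bar R) h xi : \bar R :=
  ereal_inf [set ((hdot (cost xi) (rcons h x))%:E + V (rcons h x))%E
            | x in feasible h xi].

Variable P : mslp R d M.
Local Notation T := (horizon P).

(* The recursion runs on the number r of remaining stages:
   [cost_to_go r] is Q_{T+1-r}. *)
Fixpoint cost_to_go (r : nat) h : \bar R :=
  if r is r'.+1 then
    rho P (T - r') (fun j => stage_value (cost_to_go r') h (supp P (T - r') j))
  else 0%E.

Definition recourse (t : nat) h : \bar R := cost_to_go (T.+1 - t) h.

(* Q_1(x_0). *)
Definition optimal_value : \bar R := stage_value (recourse 2) [:: x0 P] (xi1 P).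

Definition first_stage_optimal x : Prop :=
  feasible [:: x0 P] (xi1 P) x /\
  ((hdot (cost (xi1 P)) [:: x0 P; x])%:E + recourse 2 [:: x0 P; x]
     = optimal_value)%E.

Definition wmean (t : nat) (p : 'rV[R]_M) (Z : 'I_M -> \bar R) : \bar R :=
  (\sum_j (p 0 j * Phi P t j)%:E * Z j)%E.

Definition coherent (r : ('I_M -> \bar R) -> \bar R) : Prop :=
  [/\ forall Z : 'I_M -> R, r (EFin \o Z) \is a fin_num,
      forall Z Z' : 'I_M -> R, (forall j, Z j <= Z' j) ->
        (r (EFin \o Z) <= r (EFin \o Z'))%E,
      forall Z Z' : 'I_M -> R,
        (r (fun j => (Z j + Z' j)%:E) <= r (EFin \o Z) + r (EFin \o Z'))%E,
      forall (a : R) (Z : 'I_M -> R), 0 <= a ->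
        r (fun j => (a * Z j)%:E) = (a%:E * r (EFin \o Z))%E
    & forall (c : R) (Z : 'I_M -> R),
        r (fun j => (Z j + c)%:E) = (r (EFin \o Z) + c%:E)%E].

Definition law_invariant (t : nat) (r : ('I_M -> \bar R) -> \bar R) : Prop :=
  forall Z Z' : 'I_M -> R,
    (forall a, \sum_(j | Z j == a) Phi P t j = \sum_(j | Z' j == a) Phi P t j) ->
    r (EFin \o Z) = r (EFin \o Z').

Definition dual_representation (t : nat) (r : ('I_M -> \bar R) -> \bar R)
    (D : set 'rV[R]_M) : Prop :=
  [/\ convex_set D,
      D `<=` [set p | (forall j, 0 <= p 0 j) /\ \sum_j p 0 j * Phi P t j = 1]
    & forall Z, r Z = ereal_sup [set wmean t p Z | p in D]].

Definition risk_assumptions : Prop :=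
  forall t, (2 <= t <= T)%N ->
    [/\ coherent (rho P t), law_invariant t (rho P t)
      & dual_representation t (rho P t) (dens P t)].

(* [xit] is a realization of (xi_1, ..., xi_t). *)
Definition realization (t : nat) (xit : nat -> stage_data R d) : Prop :=
  xit 1 = xi1 P /\ forall s, (2 <= s <= t)%N -> exists j, xit s = supp P s j.

Definition bounded_nonempty_recourse : Prop :=
  forall t, (1 <= t <= T)%N -> forall xit, realization t xit ->
  forall h, size h = t -> h`_0 = x0 P ->
    (forall s, (1 <= s < t)%N -> feasible (take s h) (xit s) h`_s) ->
  bounded_set (feasible h (xit t)) /\ feasible h (xit t) !=set0.

End Problem.

Section Randomness.
Context (R : realType) (d M : nat) (P : mslp R d M).
Context (dd : measure_display) (Omega : measurableType dd)
        (Pr : probability Omega R).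

Definition finitely_supported (xi : nat -> Omega -> stage_data R d) : Prop :=
  (forall w, xi 1 w = xi1 P) /\
  forall t, (2 <= t <= horizon P)%N ->
    \sum_j Phi P t j = 1 /\
    forall j, [/\ measurable [set w | xi t w = supp P t j],
      Pr [set w | xi t w = supp P t j] = (Phi P t j)%:E & 0 < Phi P t j].

(* Mutual independence of xi_2, ..., xi_T (xi_1 is constant), which are
   discrete: product rule on atoms, for every subfamily of stages. *)
Definition interstage_independent (xi : nat -> Omega -> stage_data R d) : Prop :=
  forall (s : seq nat) (j : nat -> 'I_M),
    uniq s -> all (fun t => 2 <= t <= horizon P)%N s ->
    Pr (\bigcap_(t in [set` s]) [set w | xi t w = supp P t (j t)])
      = (\prod_(t <- s) Pr [set w | xi t w = supp P t (j t)])%E.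

(* [smp k t w] is the index j with xi_t^k = xi_{t,j}.  The generators below
   are the events determined by xi_s^l for l < k, 2 <= s <= T, and by xi_s^k
   for 2 <= s < t. *)
Definition past (smp : nat -> nat -> Omega -> 'I_M) (k t : nat) :
    set (set Omega) :=
  [set A | exists l s i,
     [/\ (1 <= l)%N, (2 <= s <= horizon P)%N,
         (l < k)%N || ((l == k) && (s < t)%N)
       & A = [set w | smp l s w = i]]].

Definition sampling_assumption (smp : nat -> nat -> Omega -> 'I_M) : Prop :=
  forall t (j : 'I_M) k, (2 <= t <= horizon P)%N -> (1 <= k)%N ->
    [/\ measurable [set w | smp k t w = j],
        Pr [set w | smp k t w = j] = (Phi P t j)%:E
      & forall B, <<s past smp k t >> B ->
          Pr ([set w | smp k t w = j] `&` B)
            = (Pr [set w | smp k t w = j] * Pr B)%E].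

End Randomness.

(* [None] is n_0, [Some [::]] is n_1, and a node of stage
   t >= 2 is [Some [:: j_t; ...; j_2]], the latest index first. *)

Section Tree.
Context (M : nat).

Definition node := option (seq 'I_M).

Definition stage (n : node) : nat := if n is Some s then (size s).+1 else 0.

Definition parent (n : node) : node :=
  if n is Some (_ :: s) then Some s else None.

Definition child (n : node) (j : 'I_M) : node :=
  if n is Some s then Some (j :: s) else Some [::].

Definition children (n : node) : seq node :=
  if n is Some _ then [seq child n j | j <- enum 'I_M] else [:: Some [::]].

(* The nodes from n_0 to n, in order of stages. *)
Definition lineage (n : node) : seq node :=
  [seq iter (stage n - i) parent n | i <- iota 0 (stage n).+1].

(* The node n_t on the scenario (xi_{2,j 2}, ..., xi_{t,j t}). *)
Definition scenario_node (j : nat -> 'I_M) (t : nat) : node :=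
  if t is t'.+1 then Some [seq j i | i <- rev (iota 2 t')] else None.

Definition node_data (R : realType) (d : nat) (P : mslp R d M) (m : node) :
    stage_data R d :=
  if m is Some (j :: _) then supp P (stage m) j else xi1 P.

End Tree.

(* theta + <beta, x_{1:t-1} - x^l>, with x^l = [oref]; theta = -oo allowed. *)
Record ocut (R : realType) (d : nat) := OCut {
  otheta : \bar R;
  obeta : nat -> 'cV[R]_d;
  oref : hist R d }.

(* <tilde beta, x_{1:t}> <= tilde theta. *)
Record fcut (R : realType) (d : nat) := FCut {
  ftheta : R;
  fbeta : nat -> 'cV[R]_d }.

Record multipliers (R : realType) (q : nat) := Multipliers {
  mu1 : 'cV[R]_q;
  mu2 : nat -> R;
  mu3 : nat -> R }.

Section Subproblems.
Context (R : realType) (d : nat).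
Implicit Types (h : hist R d) (xi : stage_data R d) (x : 'cV[R]_d)
  (oc : seq (ocut R d)) (fc : seq (fcut R d)).

Definition ocut_val (c : ocut R d) h : \bar R :=
  (otheta c + (\sum_(1 <= i < size h) dotv (obeta c i) (h`_i - (oref c)`_i))%:E)%E.

Definition cut_model oc h : \bar R := \big[maxe/-oo%E]_(c <- oc) ocut_val c h.

Definition fcuts_hold fc h : Prop :=
  forall l : 'I_(size fc),
    hdot (fbeta (tnth (in_tuple fc) l)) h <= ftheta (tnth (in_tuple fc) l).

(* Stage problem of a child m of n, in the variables (x_t, z): h is x_{[n]}^k,
   xi is xi_m, [oc] the optimality cuts for Q_{t+1} and [fc] the feasibility
   cuts on x_{1:t}. *)
Definition sub_feasible h xi oc fc : set ('cV[R]_d * R) :=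
  [set u | [/\ feasible h xi u.1,
     forall l : 'I_(size oc),
       (ocut_val (tnth (in_tuple oc) l) (rcons h u.1) <= u.2%:E)%E
   & fcuts_hold fc (rcons h u.1)]].

Definition sub_cost h xi (u : 'cV[R]_d * R) : R :=
  hdot (cost xi) (rcons h u.1) + u.2.

Definition sub_value h xi oc fc : \bar R :=
  ereal_inf [set (sub_cost h xi u)%:E | u in sub_feasible h xi oc fc].

(* A cut with theta = -oo imposes nothing on z; since 0 * -oo = 0, the
   Lagrangian is then > -oo only if the multiplier of that cut is 0. *)
Definition sub_lagrangian h xi oc fc (mu : multipliers R (nrows xi))
    (u : 'cV[R]_d * R) : \bar R :=
  ((sub_cost h xi u + dotv (mu1 mu) (residual h xi u.1)
    + \sum_(l < size fc) mu3 mu l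
        * (hdot (fbeta (tnth (in_tuple fc) l)) (rcons h u.1)
           - ftheta (tnth (in_tuple fc) l)))%:E
   + \sum_(l < size oc) (mu2 mu l)%:E
        * (ocut_val (tnth (in_tuple oc) l) (rcons h u.1) - (u.2)%:E))%E.

(* Optimal (Lagrange, Kuhn-Tucker) multipliers: nonnegative for the
   inequalities, and the dual function takes the optimal value. *)
Definition sub_multipliers h xi oc fc (mu : multipliers R (nrows xi)) : Prop :=
  [/\ forall l, (l < size oc)%N -> 0 <= mu2 mu l,
      forall l, (l < size fc)%N -> 0 <= mu3 mu l
    & ereal_inf [set sub_lagrangian h oc fc mu u | u in [set u | nonneg u.1]]
        = sub_value h xi oc fc].

(* pi_{k,m}, by blocks. *)
Definition sub_gradient xi oc fc (mu : multipliers R (nrows xi)) (i : nat) :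
    'cV[R]_d :=
  cost xi i + (tech xi i)^T *m mu1 mu
  + \sum_(l < size oc) mu2 mu l *: obeta (tnth (in_tuple oc) l) i
  + \sum_(l < size fc) mu3 mu l *: fbeta (tnth (in_tuple fc) l) i.

(* Phase I problem, in the variables (x_t, y_1, y_2). *)
Definition p1_vars xi : Type := ('cV[R]_d * 'cV[R]_(nrows xi) * 'cV[R]_(nrows xi)).

Definition p1_nonneg xi : set (p1_vars xi) :=
  [set u | [/\ nonneg u.1.1, nonneg u.1.2 & nonneg u.2]].

Definition p1_cost xi (u : p1_vars xi) : R := \sum_i (u.1.2 + u.2) i 0.

Definition p1_feasible h xi fc : set (p1_vars xi) :=
  [set u | [/\ p1_nonneg u, residual h xi u.1.1 + u.1.2 - u.2 = 0
    & fcuts_hold fc (rcons h u.1.1)]].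

Definition p1_value h xi fc : \bar R :=
  ereal_inf [set (p1_cost u)%:E | u in @p1_feasible h xi fc].

Definition p1_lagrangian h xi fc (mu : 'cV[R]_(nrows xi) * (nat -> R))
    (u : p1_vars xi) : R :=
  p1_cost u + dotv mu.1 (residual h xi u.1.1 + u.1.2 - u.2)
  + \sum_(l < size fc) mu.2 l
      * (hdot (fbeta (tnth (in_tuple fc) l)) (rcons h u.1.1)
         - ftheta (tnth (in_tuple fc) l)).

Definition p1_multipliers h xi fc (mu : 'cV[R]_(nrows xi) * (nat -> R)) : Prop :=
  (forall l, (l < size fc)%N -> 0 <= mu.2 l) /\
  ereal_inf [set (p1_lagrangian h fc mu u)%:E | u in @p1_nonneg xi]
    = p1_value h xi fc.

Definition p1_gradient xi fc (mu : 'cV[R]_(nrows xi) * (nat -> R)) (i : nat) :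
    'cV[R]_d :=
  (tech xi i)^T *m mu.1
  + \sum_(l < size fc) mu.2 l *: fbeta (tnth (in_tuple fc) l) i.

(* The feasibility cut for x_{1:t-1}, with v the (finite) Phase I value. *)
Definition new_fcut h xi fc (v : R) (mu : 'cV[R]_(nrows xi) * (nat -> R)) :
    fcut R d :=
  FCut (- v + hdot (p1_gradient fc mu) h) (p1_gradient fc mu).

End Subproblems.

(* What the algorithm leaves unspecified: the order in which the children of a
   node are visited and the choice among optimal solutions and multipliers.
   These choices are functions of the iteration, the node and the data of the
   subproblem, hence independent of the rest of the sample. *)
Record solvers (R : realType) (d M : nat) (P : mslp R d M) := Solvers {
  visit : nat -> node M -> seq (node M);
  p1_mult : nat -> forall m : node M, hist R d -> seq (fcut R d) ->
    'cV[R]_(nrows (node_data P m)) * (nat -> R);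
  sub_sol : nat -> node M -> hist R d -> seq (ocut R d) -> seq (fcut R d) ->
    'cV[R]_d;
  sub_mult : nat -> forall m : node M,
    hist R d -> seq (ocut R d) -> seq (fcut R d) ->
    multipliers R (nrows (node_data P m));
  risk_sol : nat -> node M -> ('I_M -> \bar R) -> 'rV[R]_M }.

Section Algorithm.
Context (R : realType) (d M : nat) (P : mslp R d M).
Local Notation T := (horizon P).
Local Notation xi := (node_data P).

(* Q^{k-1} is identically -oo. *)
Definition no_cut (oc : seq (ocut R d)) : bool :=
  all (fun c => otheta c == -oo%E) oc.

Definition correct_solvers (S : solvers P) : Prop :=
  [/\ forall k n, perm_eq (visit S k n) (children n),
      forall k m h fc, p1_value h (xi m) fc \is a fin_num ->
        p1_multipliers h fc (p1_mult S k m h fc),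
      forall k m h oc fc, sub_value h (xi m) oc fc \is a fin_num ->
        (exists z,
          sub_feasible h (xi m) oc fc (sub_sol S k m h oc fc, z) /\
          (sub_cost h (xi m) (sub_sol S k m h oc fc, z))%:E
            = sub_value h (xi m) oc fc) /\
        sub_multipliers h oc fc (sub_mult S k m h oc fc),
      forall k m h oc fc, no_cut oc ->
        sub_feasible h (xi m) oc fc !=set0 ->
        exists z, sub_feasible h (xi m) oc fc (sub_sol S k m h oc fc, z)
    & forall k n Z, (2 <= (stage n).+1 <= T)%N ->
        (forall j, Z j \is a fin_num) ->
        dens P (stage n).+1 (risk_sol S k n Z) /\
        forall p, dens P (stage n).+1 p ->
          (wmean P (stage n).+1 p Z
             <= wmean P (stage n).+1 (risk_sol S k n Z) Z)%E].

Variable S : solvers P.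

(* State of a forward pass: the decisions x_{0:t-1}^k along the sampled path
   (t is the size) and the feasibility cuts, [fc t] being the K_t cuts on
   x_{1:t}. *)
Inductive forward_state :=
| Forward of hist R d & (nat -> seq (fcut R d))
| ForwardInfeasible.

(* One turn of the while loop of iteration k, [j] being the sample and [oc t]
   the optimality cuts 0, ..., k-1 for Q_t.  Multipliers of the Phase I problem
   exist only if it is feasible; when it is not and t > 1, no cut can be built
   and the state is left unchanged, so that the pass never completes. *)
Definition forward_step (k : nat) (j : nat -> 'I_M) (oc : nat -> seq (ocut R d))
    (s : forward_state) : forward_state :=
  if s is Forward h fc then
    let t := size h in
    if (T < t)%N then s else
    match [seq m <- visit S k (scenario_node j t.-1)
          | (0 < p1_value h (xi m) (fc t))%E] with
    | [::] =>
        let m := scenario_node j t in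
        Forward (rcons h (sub_sol S k m h (oc t.+1) (fc t))) fc
    | m :: _ =>
        if t == 1 then ForwardInfeasible else
        if p1_value h (xi m) (fc t) is v%:E then
          let c := new_fcut h (fc t) v (p1_mult S k m h (fc t)) in
          Forward (take t.-1 h)
            (fun s => if s == t.-1 then rcons (fc s) c else fc s)
        else s
    end
  else s.

Definition forward_done (s : forward_state) : bool :=
  if s is Forward h _ then (T < size h)%N else true.

(* Final states are fixed by [forward_step]: the state reached does not depend
   on the chosen number of turns.  It is not final iff the loop never ends. *)
Definition forward_pass (k : nat) (j : nat -> 'I_M)
    (oc : nat -> seq (ocut R d)) (fc : nat -> seq (fcut R d)) : forward_state :=
  let run N := iter N (forward_step k j oc) (Forward [:: x0 P] fc) in
  run (xget 0%N [set N | forward_done (run N)]).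

(* x_m^k, meaningful if the sampled scenario passes through the parent of m;
   [h] is the decision path of the completed forward pass. *)
Definition decision (k : nat) (j : nat -> 'I_M) (oc : nat -> seq (ocut R d))
    (fc : nat -> seq (fcut R d)) (h : hist R d) (m : node M) : 'cV[R]_d :=
  let t := stage m in
  if m == scenario_node j t then h`_t
  else sub_sol S k m (take t h) (oc t.+1) (fc t).

(* theta_t^k, beta_t^k and the point x_{[n]}^k, n = n_{t-1}^k. *)
Definition new_ocut (k : nat) (j : nat -> 'I_M) (oc : nat -> seq (ocut R d))
    (fc : nat -> seq (fcut R d)) (h : hist R d) (t : nat) : ocut R d :=
  let n := scenario_node j t.-1 in
  let hn := take t h in
  if (T < t)%N then OCut 0%E (fun=> 0) hn else
  if no_cut (oc t.+1) then OCut -oo%E (fun=> 0) hn else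
  let v i := sub_value hn (xi (child n i)) (oc t.+1) (fc t) in
  let g i := sub_gradient (oc t.+1) (fc t)
    (sub_mult S k (child n i) hn (oc t.+1) (fc t)) in
  let p := risk_sol S k n v in
  OCut (wmean P t p v)
    (fun s => \sum_(i < M) (p 0 i * Phi P t i) *: g i s) hn.

Record alg_state := AlgState {
  ocuts : nat -> seq (ocut R d);
  fcuts : nat -> seq (fcut R d);
  dec : node M -> 'cV[R]_d }.

Definition init_state : alg_state :=
  AlgState
    (fun t => [:: OCut (if (T < t)%N then 0%E else -oo%E) (fun=> 0) [::]])
    (fun=> [::]) (fun=> 0).

Inductive alg_status :=
| Running of alg_state
| ReportedInfeasible
| ForwardDiverged.

Definition iteration (k : nat) (j : nat -> 'I_M) (st : alg_state) : alg_status :=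
  let oc := ocuts st in
  match forward_pass k j oc (fcuts st) with
  | Forward h fc =>
      if (T < size h)%N then
        Running (AlgState (fun t => rcons (oc t) (new_ocut k j oc fc h t)) fc
                          (decision k j oc fc h))
      else ForwardDiverged
  | ForwardInfeasible => ReportedInfeasible
  end.

(* Status after iterations 1, ..., k on the samples smp 1, ..., smp k. *)
Fixpoint alg_run (smp : nat -> nat -> 'I_M) (k : nat) : alg_status :=
  if k is k'.+1 then
    if alg_run smp k' is Running st then iteration k (smp k) st
    else alg_run smp k'
  else Running init_state.

Definition completed (smp : nat -> nat -> 'I_M) (k : nat) : Prop :=
  exists st, alg_run smp k = Running st.

(* Meaningful if iteration k is completed. *)
Definition state_after (smp : nat -> nat -> 'I_M) (k : nat) : alg_state :=
  if alg_run smp k is Running st then st else init_state.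

(* (x_0, x_{[n]}^k). *)
Definition node_hist (smp : nat -> nat -> 'I_M) (k : nat) (n : node M) : hist R d :=
  [seq if m is Some _ then dec (state_after smp k) m else x0 P | m <- lineage n].

(* Q_t^k. *)
Definition recourse_model (smp : nat -> nat -> 'I_M) (k t : nat) (h : hist R d) :
    \bar R :=
  cut_model (ocuts (state_after smp k) t) h.

(* frak Q_1^k(x_0, xi_1), the value of the first stage problem of iteration
   k+1. *)
Definition first_stage_bound (smp : nat -> nat -> 'I_M) (k : nat) : \bar R :=
  sub_value [:: x0 P] (xi1 P) (ocuts (state_after smp k) 2)
    (fcuts (state_after smp k.+1) 1).

Definition first_stage_decision (smp : nat -> nat -> 'I_M) (k : nat) :
    'cV[R]_d :=
  dec (state_after smp k) (Some [::]).

(* The iterations whose sampled scenario passes through the parent of n. *)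
Definition parent_sampled (smp : nat -> nat -> 'I_M) (n : node M) : set nat :=
  [set k | (1 <= k)%N /\ scenario_node (smp k) (stage (parent n)) = parent n].

End Algorithm.

(* Main.v *)
From HB Require Import structures.
Require Import Defs.
From mathcomp Require Import all_boot all_order all_algebra.
From mathcomp Require Import all_classical all_reals all_analysis.
From mathcomp Require Import ring lra.

Set Implicit Arguments.
Unset Strict Implicit.
Unset Printing Implicit Defensive.

Import Order.TTheory GRing.Theory Num.Theory.
Import numFieldNormedType.Exports.

Local Open Scope classical_set_scope.
Local Open Scope ring_scope.

(** A feasible history can always be continued, so every Phase I problem that
    the algorithm meets has value zero: no feasibility cut is ever created, each
    forward pass consists of exactly one step per stage and the problem is never
    reported infeasible ([forward_passE], [alg_runE]).  It is the second
    alternative of the theorem that has to be proved.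

    At each iteration, imagine that the stage problems are solved, from the cuts
    available when the iteration starts, at all nodes of the tree and not only
    along the sampled scenario.  The resulting histories [trial_hist] are
    functions of the samples of the previous iterations, and they coincide with
    the decisions of the algorithm wherever it computes some ([node_histE]).
    The heart of the proof is [gaps_vanish]: almost surely, at every node, the
    difference between the recourse function and its cut model at the trial
    history tends to 0 along all iterations.  This goes by backward induction on
    the stage of the node n.

    - At an iteration whose sample passes through n, a cut is added at the trial
      history of n, and it is exact up to the largest gap at the children of n,
      which vanishes by induction ([added_cut_tight]).
    - Cuts that are asymptotically exact at a sequence of feasible histories
      have, at the later histories of that sequence, a maximum close to the
      recourse function ([cuts_catch_up]); so the gap at n vanishes along the
      iterations that sample n ([gap_sampled]).
    - Whether the gap at n is larger than e is known before the sample is drawn,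
      and the sample then passes through n with a fixed positive probability.
      By a conditional Borel-Cantelli argument ([recurrent_hits]), a gap that is
      larger than e infinitely often is almost surely so at infinitely many
      iterations that sample n, which the previous point excludes.

    The usual proof of the second point relies on a common Lipschitz constant
    for all cuts.  Here the slopes of the cuts may be unbounded, because a
    history on the boundary of the domain of a value function may have arbitrarily
    large multipliers.  Polyhedrality replaces the Lipschitz property.  The
    feasible histories of a node form a polytope, so that the segment from a
    limit point h to a nearby feasible history x can be prolonged inside it by a
    large factor ([feasible_hist_prolong]).  A cut at x stays below the
    recourse function, which is bounded, on the whole prolonged segment; hence
    it loses little from x to h.

    The bound on the value of the first stage problem is within the gap at the
    node n_1 of the optimal value.  That accumulation points of the first stage
    decisions are optimal uses in addition that the recourse functions are lower
    semicontinuous on feasible histories, a consequence of the compactness of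
    the feasible sets ([recourse_bounded_lsc]). *)

(** * Cluster points of bounded sequences *)

Definition frequently (B : set nat) : Prop :=
  forall K, exists k, (K <= k)%N /\ B k.

(** Bolzano-Weierstrass in a form that avoids extracting subsequences: indices
    close to the limit keep occurring inside [B]. *)
Lemma frequently_cluster (R : realType) (I : finType) (v : nat -> I -> R)
    (C : R) (B : set nat) :
  (forall k i, B k -> `|v k i| <= C) -> frequently B ->
  exists l : I -> R, forall e : R, 0 < e ->
    frequently [set k | B k /\ forall i, `|v k i - l i| < e].
Proof.
move=> vC Binf.
pose row k : 'rV[R]_#|I| := \row_(i < #|I|) v k (enum_val i).
pose F := row @ (within B \oo).
have PF : ProperFilter F.
  apply: fmap_proper_filter; apply: Build_ProperFilter_ex => A [N _ NA].
  have [k [Nk Bk]] := Binf N.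
  by exists k; apply: (NA k).
have Cc := @rV_compact R #|I| (fun=> `[(- C), C]%classic)
  (fun=> @segment_compact _ _ _).
have FC : F [set u : 'rV[R]_#|I| | forall i, `[(- C), C]%classic (u ord0 i)].
  exists 0%N => // k _ Bk i /=.
  by rewrite mxE in_itv /= -ler_norml vC.
have [p [_ pF]] := Cc _ PF FC.
exists (fun i => p 0 (enum_rank i)) => e e0 K.
have /= := pF [set u | exists k, [/\ (K <= k)%N, B k & u = row k]]
  (ball p e) _ (nbhsx_ballx _ _ e0).
case.
  by exists K => // k /= Kk Bk; exists k.
move=> _ [[k [Kk Bk ->]] kp].
exists k; split => //; split => // i.
have [_ kp2] := kp.
by have := kp2 0 (enum_rank i); rewrite /ball /= mxE enum_rankK distrC.
Qed.

(** * Recurrence of events hit with a fixed conditional probability *)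

(** [agree k w w'] says that [w] and [w'] have the same past at time [k]; the
    event [H k] is decided just after time [k] and has conditional probability
    [q] given that past. *)
Section AdaptiveRecurrence.
Context (R : realType) (dd : measure_display) (W : measurableType dd)
  (Pr : probability W R) (agree : nat -> W -> W -> Prop)
  (H : nat -> set W) (q : R).

Definition determined (k : nat) (A : set W) : Prop :=
  forall w w', agree k w w' -> A w -> A w'.

Hypothesis q0 : 0 < q.
Hypothesis agree_sym : forall k w w', agree k w w' -> agree k w' w.
Hypothesis agree_mono : forall k l w w', (k <= l)%N -> agree l w w' -> agree k w w'.
Hypothesis H_det : forall k, determined k.+1 (H k).
Hypothesis H_indep : forall k A, determined k A ->
  measurable A /\ Pr (H k `&` A) = (q%:E * Pr A)%E.

(** The event that [E] occurs at time [k] for the (r+1)-st time and that [H]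
    missed all its earlier occurrences. *)
Fixpoint occurrence (E : nat -> set W) (r k : nat) : set W :=
  if r is r'.+1 then
    E k `&` [set w | exists i, [/\ (i < k)%N, occurrence E r' i w, ~ H i w
                     & forall l, (i < l < k)%N -> ~ E l w]]
  else E k `&` [set w | forall l, (l < k)%N -> ~ E l w].

Section Hits.
Variable E : nat -> set W.
Hypothesis E_det : forall k, determined k (E k).

Lemma occurrence_det r k : determined k (occurrence E r k).
Proof.
elim: r k => [|r IH] k w w' a /= [Ew P]; (split; first exact: E_det a Ew).
  move=> l lk; apply: contra_not (P l lk); apply: E_det.
  by apply: agree_sym; apply: agree_mono a; exact: ltnW.
case: P => i [ik Oi Hi El]; exists i; split => //.
- by apply: IH Oi; apply: agree_mono a; exact: ltnW.
- by apply: contra_not Hi; apply: H_det; apply: agree_sym; apply: agree_mono a.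
- move=> l /andP[il lk]; have := El l; rewrite il lk => /(_ isT).
  apply: contra_not; apply: E_det.
  by apply: agree_sym; apply: agree_mono a; exact: ltnW.
Qed.

Lemma occurrence_E r k w : occurrence E r k w -> E k w.
Proof. by case: r => [|r] []. Qed.

Lemma occurrence_inj r k k' w :
  occurrence E r k w -> occurrence E r k' w -> k = k'.
Proof.
elim: r k k' => [|r IH] k k' O1 O2.
  case: O1 => [Ek P]; case: O2 => [Ek' P'].
  by have [kk|kk|//] := ltngtP k k'; [have /(_ Ek) := P' _ kk|have /(_ Ek') := P _ kk].
case: O1 => [Ek [i [ik Oi _ P]]]; case: O2 => [Ek' [i' [ik' Oi' _ P']]].
have ii := IH _ _ Oi Oi'; subst i'.
have [kk|kk|//] := ltngtP k k'.
  by have := P' k; rewrite ik kk => /(_ isT)/(_ Ek).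
by have := P k'; rewrite ik' kk => /(_ isT)/(_ Ek').
Qed.

Lemma occurrence_measurable r k : measurable (occurrence E r k).
Proof. by have [] := H_indep (occurrence_det (r := r) (k := k)). Qed.

Lemma measurable_hit k : measurable (H k).
Proof. by have [] := H_indep (H_det (k := k)). Qed.

Lemma q_le1 : q <= 1.
Proof.
have [] := @H_indep 0%N setT; first by [].
move=> _; rewrite setIT probability_setT mule1 -lee_fin => <-.
exact: probability_le1 (measurable_hit _).
Qed.

Lemma prob_missed r k :
  Pr (occurrence E r k `\` H k) = ((1 - q)%:E * Pr (occurrence E r k))%E.
Proof.
have [mO PO] := H_indep (occurrence_det (r := r) (k := k)).
rewrite measureD //; last 2 first.
- exact: measurable_hit.
- by rewrite (le_lt_trans (probability_le1 _ _)) ?ltry.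
rewrite [X in (_ - X)%E](_ : _ = q%:E * Pr (occurrence E r k))%E; last first.
  by rewrite setIC; exact: PO.
rewrite EFinB muleBl ?mul1e //.
exact: fin_num_measure.
Qed.

(** Each further occurrence requires the previous one to have been missed, and
    the times of the r-th occurrence are disjoint events, so that the factor
    [1 - q] can be taken out of the sum over these times. *)
Lemma prob_occurrence r :
  (Pr (\bigcup_k occurrence E r k) <= ((1 - q) ^+ r)%:E)%E.
Proof.
have mO := occurrence_measurable.
elim: r => [|r IH].
  by rewrite expr0; apply: probability_le1; apply: bigcup_measurable => k _; exact: mO.
have sub : \bigcup_k occurrence E r.+1 k `<=` \bigcup_k (occurrence E r k `\` H k).
  by move=> w [k _ [_ [i [_ Oi Hi _]]]]; exists i.
have mD k : measurable (occurrence E r k `\` H k).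
  by apply: measurableD; [exact: mO|exact: measurable_hit].
have bU F : (forall k, measurable (F k)) -> trivIset setT F ->
    Pr (\bigcup_k F k) = (\sum_(0 <= k <oo) Pr (F k))%E.
  by move=> mF tF; rewrite measure_bigcup //; apply: eq_eseriesl => k; rewrite in_setT.
apply: (@le_trans _ _ (Pr (\bigcup_k (occurrence E r k `\` H k)))).
  apply: le_measure => //; rewrite inE; apply: bigcup_measurable => k _.
  - exact: mO.
  - exact: mD.
rewrite bU //; last first.
  by move=> i j _ _ [w [[Oi _] [Oj _]]]; exact: occurrence_inj Oi Oj.
rewrite (eq_eseriesr (g := fun k => ((1 - q)%:E * Pr (occurrence E r k))%E)); last first.
  by move=> k _; exact: prob_missed.
rewrite nneseriesZl //.
rewrite exprS EFinM lee_wpmul2l //.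
  by rewrite lee_fin subr_ge0 q_le1.
rewrite -bU //.
by move=> i j _ _ [w [Oi Oj]]; exact: occurrence_inj Oi Oj.
Qed.

Lemma missed_occurrence w r : frequently (E^~ w) ->
  (forall k, ~ (E k w /\ H k w)) -> exists k, occurrence E r k w.
Proof.
move=> fE noH.
have next (K : nat) : exists k, [/\ (K <= k)%N, E k w & forall l, (K <= l < k)%N -> ~ E l w].
  have ex : exists k, (K <= k)%N && `[< E k w >].
    by have [k [Kk Ek]] := fE K; exists k; rewrite Kk; apply/asboolP.
  have [k /andP[Kk /asboolP Ek] kmin] := ex_minnP ex; exists k; split => //.
  move=> l /andP[Kl lk] El; have := kmin l; rewrite Kl asboolT // => /(_ isT).
  by rewrite leqNgt lk.
elim: r => [|r [i Oi]].
  by have [k [_ Ek P]] := next 0%N; exists k; split.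
have [k [ik Ek P]] := next i.+1; exists k; split => //; exists i; split => //.
by move=> Hi; apply: (noH i); split => //; exact: occurrence_E Oi.
Qed.

Lemma never_hit_negligible :
  Pr.-negligible [set w | frequently (E^~ w) /\ forall k, ~ (E k w /\ H k w)].
Proof.
pose U r := \bigcup_k occurrence E r k.
have mU r : measurable (U r).
  by apply: bigcup_measurable => k _; exact: occurrence_measurable.
have mI : measurable (\bigcap_r U r) by apply: bigcap_measurable.
exists (\bigcap_r U r); split => //; last first.
  move=> w [fE noH] r _; have [k Ok] := missed_occurrence r fE noH.
  by exists k.
apply/eqP; rewrite eq_le measure_ge0 andbT.
have Pfin := fin_num_measure Pr _ mI.
rewrite -(fineK Pfin) lee_fin.
have cv : (fun r => (1 - q) ^+ r) @ \oo --> (0 : R).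
  apply: cvg_expr; rewrite ltr_norml; apply/andP; split; have := q_le1; have := q0; lra.
rewrite -(cvg_lim _ cv) //; apply: limr_ge; first exact: cvgP cv.
near=> r; rewrite -lee_fin fineK //; apply: le_trans (prob_occurrence r).
apply: le_measure; [by rewrite inE| |].
  by rewrite inE; exact: mU.
by move=> w Iw; exact: Iw.
Unshelve. all: by end_near. Qed.
End Hits.

(** Conditional Borel-Cantelli: events that are known before a trial of success
    probability [q] and occur infinitely often also occur infinitely often
    together with a success.  If hits stop at time [K], then the occurrences
    after [K] form an infinite sequence of missed ones. *)
Lemma recurrent_hits (E : nat -> set W) :
  (forall k, determined k (E k)) ->
  {ae Pr, forall w, frequently (E^~ w) -> frequently [set k | E k w /\ H k w]}.
Proof.
move=> E_det.
pose E' K k := [set w | (K <= k)%N /\ E k w].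
have E'_det K k : determined k (E' K k).
  by move=> w w' a [Kk Ew]; split => //; exact: E_det a Ew.
apply: (@negligibleS _ _ _ _ (\bigcup_K [set w | frequently (E' K ^~ w) /\
  forall k, ~ (E' K k w /\ H k w)])); last first.
  by apply: negligible_bigcup => K; exact: never_hit_negligible.
move=> w /= /not_implyP[fE /existsNP[K NH]]; exists K => //=; split.
  move=> L; have [k [Lk Ek]] := fE (maxn K L).
  by move: Lk; rewrite geq_max => /andP[Kk Lk]; exists k.
by move=> k [[Kk Ek] Hk]; apply: NH; exists k.
Qed.
End AdaptiveRecurrence.

(** * Sampled scenarios hit each node with a fixed probability *)

Lemma scenario_nodeS (M : nat) (f : nat -> 'I_M) t :
  scenario_node f t.+2 = Some (f t.+2 :: [seq f i | i <- rev (iota 2 t)]).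
Proof. by rewrite /scenario_node -(addn1 t) iotaD rev_cat /= !addn1 add2n. Qed.

Section Sampling.
Context (R : realType) (d M : nat) (P : mslp R d M)
  (dd : measure_display) (Omega : measurableType dd) (Pr : probability Omega R)
  (smp : nat -> nat -> Omega -> 'I_M).
Hypothesis sampling : sampling_assumption P Pr smp.
Hypothesis Phi_gt0 : forall t j, (2 <= t <= horizon P)%N -> 0 < Phi P t j.

Definition agree_past (k t : nat) (w w' : Omega) : Prop :=
  forall l s, (1 <= l)%N -> (2 <= s <= horizon P)%N ->
    (l < k)%N || ((l == k) && (s < t)%N) -> smp l s w = smp l s w'.

(** The past consists of finitely many finite-valued samples, so an event that
    they determine is a finite union of atoms. *)
Lemma past_determined k t (B : set Omega) :
  (forall w w', agree_past k t w w' -> B w -> B w') -> <<s past P smp k t >> B.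
Proof.
move=> Bdet.
pose I : finType := ('I_k.+1 * 'I_(horizon P).+1)%type.
pose code w : {ffun I -> 'I_M} := [ffun p : I => smp p.1 p.2 w].
pose idx := [set p : I | [/\ (1 <= p.1)%N, (2 <= p.2)%N
   & (p.1 < k)%N || ((p.1 == k :> nat) && (p.2 < t)%N)]].
have -> : B = \bigcup_(f in code @` B)
    \bigcap_(p in idx) [set w | smp p.1 p.2 w = f p].
  apply/seteqP; split=> [w Bw|w [_ [w' Bw' <-]] ww'].
    by exists (code w); [exists w|move=> p _ /=; rewrite ffunE].
  apply: Bdet Bw' => l s l1 /andP[s2 sT] lst.
  have lk : (l < k.+1)%N by rewrite ltnS; case/orP: lst => [/ltnW//|/andP[/eqP->]].
  have := ww' (Ordinal lk, Ordinal (sT : (s < (horizon P).+1)%N)).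
  by rewrite /= ffunE /= => ->.
apply: (@fin_bigcup_measurable _ (g_sigma_algebraType (past P smp k t))).
  exact: finite_finset.
move=> f _; apply: fin_bigcap_measurable; first exact: finite_finset.
move=> p [p1 p2 pk]; apply: sub_sigma_algebra.
exists p.1, p.2, (f p); split => //.
by rewrite p2 -ltnS ltn_ord.
Qed.

Lemma past_measurable k t (B : set Omega) : (1 <= k)%N ->
  (forall w w', agree_past k t w w' -> B w -> B w') -> measurable B.
Proof.
move=> k1 /past_determined; apply: (smallest_sub (@sigma_algebra_measurable _ Omega)).
move=> _ [l [s [i [l1 sT _ ->]]]].
by have [] := sampling i sT l1.
Qed.

Definition sampled (n : node M) (k : nat) : set Omega :=
  [set w | scenario_node (fun t => smp k t w) (stage n) = n].

Lemma sampled_cons j s k w :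
  sampled (Some (j :: s)) k w <->
  smp k (size s).+2 w = j /\ sampled (Some s) k w.
Proof.
rewrite /sampled /mkset.
have -> : stage (Some (j :: s)) = (size s).+2 by [].
rewrite scenario_nodeS.
have -> : stage (Some s) = (size s).+1 by [].
rewrite /scenario_node; split => [[-> ->]//|[-> [->]]//].
Qed.

Definition node_prob (n : node M) : R :=
  if n is Some s then
    (fix prob s := if s is j :: s' then Phi P (size s').+2 j * prob s' else 1) s
  else 1.

Lemma node_prob_gt0 n : (stage n <= horizon P)%N -> 0 < node_prob n.
Proof.
case: n => [s|//] /=; elim: s => [//|j s IH] /= sT.
by rewrite mulr_gt0 ?IH ?(ltnW sT) //; apply: Phi_gt0; rewrite sT.
Qed.

Lemma sampled_past n k w w' : (stage n <= horizon P)%N -> (1 <= k)%N ->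
  agree_past k (stage n).+1 w w' -> sampled n k w -> sampled n k w'.
Proof.
case: n => [s|//]; elim: s => [//|j s IH] /= sT k1 a.
move=> /sampled_cons[jw sw]; apply/sampled_cons; split.
  by rewrite -jw; apply/esym/a => //=; rewrite eqxx ltnSn orbT.
apply: IH => //; first exact: ltnW.
move=> l r l1 rT /orP[lk|/andP[lk rs]]; apply: a => //; first by rewrite lk.
by rewrite lk (leq_trans rs) ?orbT.
Qed.

(** The stages are drawn one after another, each one independently of the past
    including the earlier stages of the same iteration; hence the induction on
    the node from the latest stage. *)
Lemma sampled_indep n k (B : set Omega) :
  (stage n <= horizon P)%N -> (1 <= k)%N ->
  (forall w w', agree_past k 2 w w' -> B w -> B w') ->
  Pr (sampled n k `&` B) = ((node_prob n)%:E * Pr B)%E.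
Proof.
move=> sT k1 Bdet.
case: n sT => [s|]; last first.
  move=> _; rewrite (_ : sampled _ _ = setT) ?setTI ?mul1e //.
  by apply/seteqP; split.
elim: s => [|j s IH] sT.
  rewrite (_ : sampled _ _ = setT) ?setTI ?mul1e //.
  by apply/seteqP; split.
have -> : sampled (Some (j :: s)) k `&` B =
    [set w | smp k (size s).+2 w = j] `&` (sampled (Some s) k `&` B).
  apply/seteqP; split => w /=.
    by move=> [/sampled_cons[]].
  by move=> [jw [sw Bw]]; split => //; apply/sampled_cons.
have [_ Pj indep] := sampling j (sT : (2 <= (size s).+2 <= horizon P)%N) k1.
rewrite indep; last first.
  apply: past_determined => w w' a [sw Bw]; split.
    by apply: (@sampled_past (Some s) k w w' _ _ a) => //; exact: ltnW.
  apply: Bdet Bw => l r l1 rT lr; apply: a => //.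
  by case/orP: lr => [->//|/andP[-> r2]]; rewrite (leq_trans r2) ?orbT.
by rewrite Pj IH ?(ltnW sT) // muleA -EFinM.
Qed.

Lemma sampled_recurrent n (E : nat -> set Omega) :
  (stage n <= horizon P)%N ->
  (forall k w w', agree_past k.+1 2 w w' -> E k w -> E k w') ->
  {ae Pr, forall w, frequently (E^~ w) ->
     frequently [set k | E k w /\ sampled n k.+1 w]}.
Proof.
move=> nT Edet.
apply: (recurrent_hits (agree := fun k => agree_past k.+1 2)
  (H := fun k => sampled n k.+1) (node_prob_gt0 nT)) => //.
- by move=> k w w' a l s l1 sT lk; apply/esym/a.
- move=> k l w w' kl a i s i1 sT ik; apply: a => //.
  case/orP: ik => [ik|/andP[_]]; last by rewrite ltnNge; case/andP: sT => ->.
  by rewrite (leq_trans ik) ?ltnS.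
- move=> k w w' a; apply: sampled_past => // l s l1 sT lk; apply: a => //.
  rewrite ltnS; case/orP: lk => [/ltnW ->//|/andP[/eqP-> _]].
  by rewrite leqnn.
- move=> k A Adet; split; first exact: past_measurable Adet.
  exact: sampled_indep Adet.
Qed.

End Sampling.

(** * Linear forms and closeness on histories *)

Section Geometry.
Context (R : realType) (d : nat).
Implicit Types (h : hist R d) (b : nat -> 'cV[R]_d).

Lemma mx_entry_le_norm m n (A : 'M[R]_(m, n)) i j : `|A i j| <= `|A|.
Proof.
rewrite [leRHS]/Num.norm /= mx_normrE; apply/bigmax_geP; right => /=.
by exists (i, j).
Qed.

(** Missing entries of a history are read as 0, so for histories of equal size
    only the actual entries count. *)
Definition hclose (e : R) h h' : Prop := forall i a, `|h`_i a 0 - h'`_i a 0| < e.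

Definition lform b (m n : nat) h : R := \sum_(m <= i < n) dotv (b i) h`_i.

Lemma hclose_le e e' h h' : e <= e' -> hclose e h h' -> hclose e' h h'.
Proof. by move=> ee H i a; exact: lt_le_trans (H i a) ee. Qed.

Lemma dotvB (u v w : 'cV[R]_d) : dotv u (v - w) = dotv u v - dotv u w.
Proof.
rewrite /dotv -sumrB; apply: eq_bigr => i _.
by rewrite !mxE mulrBr.
Qed.

Lemma dotvD (u v w : 'cV[R]_d) : dotv u (v + w) = dotv u v + dotv u w.
Proof.
rewrite /dotv -big_split; apply: eq_bigr => i _.
by rewrite !mxE mulrDr.
Qed.

Lemma dotvZ (u v : 'cV[R]_d) s : dotv u (s *: v) = s * dotv u v.
Proof.
rewrite /dotv mulr_sumr; apply: eq_bigr => i _.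
by rewrite !mxE mulrCA.
Qed.

Lemma lform_close b m n e : 0 < e ->
  exists2 del : R, 0 < del &
    forall h h', hclose del h h' -> `|lform b m n h - lform b m n h'| < e.
Proof.
move=> e0; pose S := \sum_(m <= i < n) \sum_a `|b i a 0|.
have S0 : 0 <= S by apply: sumr_ge0 => i _; apply: sumr_ge0.
exists (e / (S + 1)); first by rewrite divr_gt0 // ltr_wpDl.
move=> h h' hh; rewrite /lform -sumrB.
apply: (@le_lt_trans _ _ (S * (e / (S + 1)))); last first.
  by rewrite mulrA ltr_pdivrMr ?ltr_wpDl // mulrC; rewrite ltr_pM2l //; lra.
rewrite /S mulr_suml; apply: le_trans (ler_norm_sum _ _ _) _.
apply: ler_sum => i _; rewrite -dotvB /dotv mulr_suml.
apply: le_trans (ler_norm_sum _ _ _) _; apply: ler_sum => a _.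
by rewrite normrM ler_wpM2l // !mxE ltW.
Qed.

Lemma lform_bound b m n C : exists C', forall h,
  (forall i a, `|h`_i a 0| <= C) -> `|lform b m n h| <= C'.
Proof.
exists (\sum_(m <= i < n) \sum_a `|b i a 0| * C) => h hC.
apply: le_trans (ler_norm_sum _ _ _) _; apply: ler_sum => i _.
apply: le_trans (ler_norm_sum _ _ _) _; apply: ler_sum => a _.
by rewrite normrM ler_wpM2l.
Qed.

Lemma min_positive (I : finType) (f : I -> R) :
  exists2 del : R, 0 < del & forall i, 0 < f i -> del <= f i.
Proof.
suff [del del0 H] : exists2 del : R, 0 < del &
    forall i, i \in enum I -> 0 < f i -> del <= f i.
  by exists del => // i; apply: H; rewrite mem_enum.
elim: (enum I) => [|x s [del del0 IH]]; first by exists 1.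
(* The initial value 1 serves when no value of f is positive. *)
exists (if 0 < f x then Num.min del (f x) else del).
  by case: ifP => // fx; rewrite lt_min del0.
move=> i; rewrite inE => /predU1P[->|ix] fi.
  by rewrite fi ge_min lexx orbT.
by case: ifP => _; rewrite ?ge_min IH.
Qed.

Lemma hist_cluster (N : nat) (v : nat -> hist R d) (u : nat -> R) C (B : set nat) :
  (forall k, B k -> [/\ size (v k) = N, forall i a, `|(v k)`_i a 0| <= C
     & `|u k| <= C]) ->
  frequently B ->
  exists h r, size h = N /\ forall e, 0 < e ->
    frequently [set k | [/\ B k, hclose e (v k) h & `|u k - r| < e]].
Proof.
move=> vB Binf; pose I : finType := option ('I_N * 'I_d).
pose w k (x : I) := if x is Some p then (v k)`_(p.1) p.2 0 else u k.
have wC k x : B k -> `|w k x| <= C.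
  by move=> Bk; have [_ ? ?] := vB _ Bk; rewrite /w; case: x => [p|] /=.
have [l lP] := frequently_cluster wC Binf.
pose h := mkseq (fun i => \col_a (if insub i is Some j then l (Some (j, a)) else 0)) N.
exists h, (l None); split; first by rewrite size_mkseq.
move=> e e0 K; have [k [Kk [Bk kl]]] := lP e e0 K.
exists k; split => //; split=> //; last exact: (kl None).
have [sz _ _] := vB k Bk.
move=> i a; have [iN|Ni] := ltnP i N; last first.
  by rewrite !nth_default ?size_mkseq ?sz // mxE subrr normr0.
rewrite nth_mkseq // mxE (insubT (fun i => i < N)%N iN).
exact: (kl (Some (Ordinal iN, a))).
Qed.

Definition hist_line (s : R) h h' : hist R d :=
  mkseq (fun i => h'`_i + s *: (h`_i - h'`_i)) (size h').

Lemma nth_hist_line s h h' i : size h = size h' ->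
  (hist_line s h h')`_i = h'`_i + s *: (h`_i - h'`_i).
Proof.
move=> sz; have [ih|hi] := ltnP i (size h'); first by rewrite nth_mkseq.
by rewrite !nth_default ?size_mkseq ?sz // subr0 scaler0 addr0.
Qed.

Lemma lform_hist_line b m n s h h' : size h = size h' ->
  lform b m n (hist_line s h h') =
    lform b m n h' + s * (lform b m n h - lform b m n h').
Proof.
move=> sz; rewrite /lform -sumrB mulr_sumr -big_split; apply: eq_bigr => i _.
by rewrite nth_hist_line // dotvD dotvZ dotvB.
Qed.

Lemma residual_entry h (xi : stage_data R d) s r : (s < size h)%N ->
  residual (take s h) xi h`_s r 0 =
    lform (fun i => (row r (tech xi i))^T) 0 s.+1 h - rhs xi r 0.
Proof.
move=> sh; rewrite /residual size_take sh /lform.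
have E : forall i, (tech xi i *m h`_i) r 0 = dotv (row r (tech xi i))^T h`_i.
  by move=> i; rewrite !mxE; apply: eq_bigr => a _; rewrite !mxE.
rewrite big_nat_recr //= !mxE summxE; congr (_ + _ - _); last first.
  by rewrite -E mxE.
apply: eq_big_nat => i /andP[_ is_].
by rewrite -E nth_take.
Qed.

(** All constraints on a history at a given stage are sign conditions and linear
    equations; this is what makes the feasible histories of a node a
    polyhedron. *)
Lemma feasible_lform h (xi : stage_data R d) s : (s < size h)%N ->
  feasible (take s h) xi h`_s <->
  nonneg h`_s /\ forall r,
    lform (fun i => (row r (tech xi i))^T) 0 s.+1 h = rhs xi r 0.
Proof.
move=> sh; split => -[h0 E]; split => //.
  move=> r; apply/eqP; rewrite -subr_eq0 -residual_entry //.
  by rewrite E mxE.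
apply/matrixP => r c; rewrite ord1 residual_entry // E mxE.
by rewrite subrr.
Qed.

End Geometry.

(** * The polytope of feasible histories of a node *)

Section FeasibleHistories.
Context (R : realType) (d M : nat) (P : mslp R d M).
Implicit Types (n m : node M) (h : hist R d).

Definition node_realization n (s : nat) : stage_data R d :=
  node_data P (iter (stage n - s) (@parent M) n).

(** A realization of the process up to a stage is the same thing as the path to
    a node of that stage; feasibility is indexed by the node. *)
Definition feasible_hist n : set (hist R d) :=
  [set h | [/\ size h = (stage n).+1, h`_0 = x0 P &
    forall s, (1 <= s <= stage n)%N ->
      feasible (take s h) (node_realization n s) h`_s]].

Lemma stage_parent m : (0 < stage m)%N -> stage m = (stage (parent m)).+1.
Proof. by case: m => [[|j s]|]. Qed.

Lemma node_realization_stage m : node_realization m (stage m) = node_data P m.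
Proof. by rewrite /node_realization subnn. Qed.

Lemma node_realization_parent m s : (s < stage m)%N ->
  node_realization m s = node_realization (parent m) s.
Proof.
move=> sm; have E := stage_parent (leq_ltn_trans (leq0n s) sm).
by rewrite /node_realization {1}E subSn ?iterSr // -ltnS -E.
Qed.

Lemma node_realizationP n t : (t <= stage n)%N -> realization P t (node_realization n).
Proof.
move=> tn; split.
  rewrite /node_realization; case: n tn => [s|//] _.
  rewrite [stage _]/= subn1 [_.-1]/=.
  suff -> : iter (size s) (@parent M) (Some s) = Some [::] by [].
  by elim: s => [//|j s IH]; rewrite [size _]/= iterSr.
move=> s /andP[s2 st]; have sn := leq_trans st tn.
elim: (stage n) {-2}n (erefl (stage n)) sn => [m -> //|k IH m mk sm].
  by rewrite leqn0 => /eqP s0; rewrite s0 in s2.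
have [sk|] := leqP s k.
  rewrite node_realization_parent; last by rewrite mk.
  have pk : stage (parent m) = k by have := @stage_parent m; rewrite mk => /(_ isT) [].
  by apply: IH => //; rewrite pk.
move=> ks; have sE : s = stage m by rewrite mk; apply/eqP; rewrite eqn_leq ks andbT -mk.
rewrite {1}sE node_realization_stage; case: m {IH mk sm} sE => [[|j r]|] sE.
- by rewrite sE in s2.
- by exists j; rewrite /= sE.
- by rewrite sE in s2.
Qed.

Lemma feasible_hist_rcons m h x : (0 < stage m)%N ->
  feasible_hist (parent m) h -> feasible h (node_data P m) x -> feasible_hist m (rcons h x).
Proof.
move=> m0 [sz h0 hf] xf; have E := stage_parent m0; split.
- by rewrite size_rcons sz E.
- by rewrite nth_rcons sz.
- move=> s /andP[s1]; rewrite leq_eqVlt => /predU1P[->|sm].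
    rewrite node_realization_stage nth_rcons sz -E ltnn eqxx.
    by rewrite -cats1 take_size_cat // sz -E.
  rewrite node_realization_parent // nth_rcons sz -E sm.
  rewrite -cats1 takel_cat; last by rewrite sz -E ltnW.
  by apply: hf; rewrite s1 -ltnS -E.
Qed.

Lemma feasible_hist_inv m h : (0 < stage m)%N -> feasible_hist m h ->
  exists h' x, [/\ h = rcons h' x, feasible_hist (parent m) h' & feasible h' (node_data P m) x].
Proof.
move=> m0 [sz h0 hf]; have E := stage_parent m0.
case/lastP: h sz h0 hf => [//|h' x]; rewrite size_rcons => -[sz] h0 hf.
exists h', x; split => //.
  split; first by rewrite sz E.
    by rewrite -h0 nth_rcons sz m0.
  move=> s /andP[s1 sm]; have sm' : (s < stage m)%N by rewrite E ltnS.
  have := hf s; rewrite s1 ltnW // => /(_ isT).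
  by rewrite node_realization_parent // nth_rcons sz sm' -cats1 takel_cat // sz ltnW.
have := hf (stage m); rewrite m0 leqnn => /(_ isT).
rewrite node_realization_stage nth_rcons sz ltnn eqxx.
by rewrite -cats1 take_size_cat.
Qed.

Lemma feasible_hist_size n h : feasible_hist n h -> size h = (stage n).+1.
Proof. by case. Qed.

Lemma feasible_hist_nonneg n h i a : (0 < i)%N -> feasible_hist n h -> 0 <= h`_i a 0.
Proof.
move=> i0 [sz _ hf]; have [im|mi] := leqP i (stage n).
  by have := hf i; rewrite i0 im => /(_ isT)[/(_ a)].
by rewrite nth_default ?sz // mxE.
Qed.

Lemma feasible_hist_closed n h : size h = (stage n).+1 ->
  (forall e, 0 < e -> exists2 h', feasible_hist n h' & hclose e h' h) -> feasible_hist n h.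
Proof.
move=> sz hcl; split => //.
  apply/matrixP => a c; rewrite ord1; apply/eqP; rewrite -subr_eq0 -normr_le0.
  apply/ler_addgt0Pr => e; rewrite add0r => /hcl[h' [_ h0 _] /(_ 0%N a)]; rewrite h0 distrC => /ltW.
  exact.
move=> s /andP[s1 sn]; apply/feasible_lform; first by rewrite sz ltnS.
split.
  move=> a; apply/ler_addgt0Pr => e /hcl[h' hf /(_ s a)].
  have := feasible_hist_nonneg a s1 hf; rewrite ltr_distl => p /andP[_].
  by move=> /ltW; exact: le_trans.
move=> r; apply/eqP; rewrite -subr_eq0 -normr_le0; apply/ler_addgt0Pr => e e0; rewrite add0r.
have [del del0 close] := lform_close
  (fun i => (row r (tech (node_realization n s) i))^T) 0 s.+1 e0.
have [h' [sz' _ hf] /close] := hcl _ del0.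
have lt' : (s < size h')%N by rewrite sz' ltnS.
have sn' : (1 <= s <= stage n)%N by rewrite s1.
have [_ ->] := (feasible_lform _ lt').1 (hf s sn').
by rewrite distrC => /ltW.
Qed.

(** Equations are preserved on the whole line.  A coordinate of [h'] that is 0
    stays nonnegative for every [s], as [h] is nonnegative, and a positive one
    stays so as long as the displacement does not exceed [del], the least
    positive coordinate. *)
Lemma feasible_hist_prolong n h' : feasible_hist n h' -> exists2 del : R, 0 < del &
  forall s h, 0 <= s -> feasible_hist n h ->
    (forall i a, s * `|h`_i a 0 - h'`_i a 0| <= del) -> feasible_hist n (hist_line s h h').
Proof.
move=> [sz h0 hf].
pose I : finType := ('I_(stage n).+1 * 'I_d)%type.
have [del del0 delP] := min_positive (fun p : I => h'`_(p.1) p.2 0).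
exists del => // s h s0 [sz' h0' hf'] close.
have szE : size h = size h' by rewrite sz sz'.
split; first by rewrite size_mkseq.
  by rewrite nth_hist_line // h0 h0' subrr scaler0 addr0.
move=> t /andP[t1 tn]; apply/feasible_lform; first by rewrite size_mkseq sz ltnS.
have tn' : (1 <= t <= stage n)%N by rewrite t1.
have lt : (t < size h)%N by rewrite sz' ltnS.
have lt' : (t < size h')%N by rewrite sz ltnS.
have [p E] := (feasible_lform _ lt').1 (hf _ tn').
have [p' E'] := (feasible_lform _ lt).1 (hf' _ tn').
split; last by move=> r; rewrite lform_hist_line // E E' subrr mulr0 addr0.
move=> a; rewrite nth_hist_line // !mxE.
have := p a; rewrite le_eqVlt => /predU1P[<-|pos].
  by rewrite oppr0 addr0 add0r mulr_ge0.
have /= := delP (Ordinal (tn : (t < (stage n).+1)%N), a) pos.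
have := close t a; rewrite -(ger0_norm s0) -normrM ler_norml => /andP[+ _].
rewrite ger0_norm //; lra.
Qed.

Section Recourse.
Hypothesis recourse_ok : bounded_nonempty_recourse P.

Lemma feasible_recourse m h : (1 <= stage m <= horizon P)%N -> feasible_hist (parent m) h ->
  bounded_set (feasible h (node_data P m)) /\ feasible h (node_data P m) !=set0.
Proof.
move=> mT [sz h0 hf]; have m0 : (0 < stage m)%N by case/andP: mT.
have E := stage_parent m0.
rewrite -node_realization_stage; apply: recourse_ok => //.
- exact: node_realizationP.
- by rewrite sz E.
- move=> s /andP[s1 sm]; rewrite node_realization_parent //.
  by apply: hf; rewrite s1 -ltnS -E.
Qed.

(** A recession direction would give an unbounded ray in the feasible set. *)
Lemma no_recession m h (u : 'cV[R]_d) : (1 <= stage m <= horizon P)%N ->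
  feasible_hist (parent m) h -> nonneg u -> tech (node_data P m) (stage m) *m u = 0 ->
  u = 0.
Proof.
move=> mT hf u0 Au; have [[C [_ bd]] [x [x0 xf]]] := feasible_recourse mT hf.
apply/matrixP => a c; rewrite ord1 mxE; apply/eqP; rewrite eq_le u0 andbT.
rewrite leNgt; apply/negP => ua.
have sz : size h = stage m.
  by have [-> _ _] := hf; rewrite -stage_parent //; case/andP: mT.
(* The step (|C| + 2) / u_a brings coordinate a beyond the bound |C| + 1. *)
have ray s : 0 <= s -> feasible h (node_data P m) (x + s *: u).
  move=> s0; split; first by move=> i; rewrite !mxE addr_ge0 ?mulr_ge0.
  by rewrite -xf /residual mulmxDr -scalemxAr sz Au scaler0 addr0.
have C1 : C < `|C| + 1 by have := ler_norm C; lra.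
have s0 : 0 <= (`|C| + 2) / u a 0 by rewrite divr_ge0 ?addr_ge0 // ltW.
have /= := bd _ C1 _ (ray _ s0).
have := mx_entry_le_norm (x + ((`|C| + 2) / u a 0) *: u) a 0.
rewrite !mxE divfK ?gt_eqF // => le1 le2.
have := le_trans (ler_norm _) (le_trans le1 le2); have := x0 a; lra.
Qed.

(** The recession cone of the feasible set of [m] does not depend on the history
    and is trivial.  If feasible decisions were unbounded over a bounded set of
    histories, a limit of their normalizations would be a nonzero element of
    that cone. *)
Lemma extension_bounded m C : (1 <= stage m <= horizon P)%N ->
  (forall h, feasible_hist (parent m) h -> forall i a, `|h`_i a 0| <= C) ->
  exists D, forall h x, feasible_hist (parent m) h -> feasible h (node_data P m) x ->
    \sum_a x a 0 <= D.
Proof.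
move=> mT hC; apply: contrapT => noD.
have /choice[g gP] : forall k : nat, exists p : hist R d * 'cV[R]_d,
    [/\ feasible_hist (parent m) p.1, feasible p.1 (node_data P m) p.2
       & k.+1%:R < \sum_a p.2 a 0].
  move=> k; apply: contrapT => nop; apply: noD; exists k.+1%:R => h x hf xf.
  by rewrite leNgt; apply/negP => lt; apply: nop; exists (h, x).
pose sg k := \sum_a (g k).2 a 0.
have sgk k : k.+1%:R < sg k by have [] := gP k.
have sg0 k : 0 < sg k by apply: le_lt_trans (sgk k).
have x0 k a : 0 <= (g k).2 a 0 by have [_ [+ _] _] := gP k; apply.
pose v k : hist R d := [:: (sg k)^-1 *: (g k).2].
have vB k : setT k -> [/\ size (v k) = 1, forall i a, `|(v k)`_i a 0| <= 1
    & `|(fun=> 0 : R) k| <= 1].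
  move=> _; split; rewrite ?normr0 //; case=> [|i] a; last first.
    by rewrite nth_default // mxE normr0.
  rewrite /v /= mxE ger0_norm ?mulr_ge0 ?invr_ge0 ?(ltW (sg0 k)) //.
  rewrite ler_pdivrMl // mulr1 /sg (bigD1 a) //= ler_wpDr //.
  by apply: sumr_ge0.
have [|h [r0 [sz close]]] := hist_cluster vB; first by move=> K; exists K.
have near b e : 0 < e -> frequently [set k | `|lform b 0 1 (v k) - lform b 0 1 h| < e].
  move=> e0 K; have [del del0 delP] := lform_close b 0 1 e0.
  by have [k [Kk [_ kh _]]] := close _ del0 K; exists k; split => //; exact: delP.
pose u := h`_0.
have u0 : nonneg u.
  move=> a; apply/ler_addgt0Pr => e e0.
  have [k [_ [_ /(_ 0%N a) + _]]] := close _ e0 0%N.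
  have : 0 <= (v k)`_0 a 0 by rewrite /v /= mxE mulr_ge0 ?invr_ge0 ?(ltW (sg0 k)).
  by rewrite ltr_distl => p /andP[_ /ltW]; exact: le_trans.
have su : \sum_a u a 0 = 1.
  have l1 (w : hist R d) : lform (fun=> const_mx 1) 0 1 w = \sum_a w`_0 a 0.
    by rewrite /lform big_nat1; apply: eq_bigr => a _; rewrite mxE mul1r.
  apply/eqP; rewrite -subr_eq0 -normr_le0; apply/ler_addgt0Pr => e e0.
  have [k [_ /=]] := near (fun=> const_mx 1) e e0 0%N.
  rewrite !l1 add0r distrC; have -> : \sum_a (v k)`_0 a 0 = 1.
    transitivity ((sg k)^-1 * sg k); last by rewrite mulVf ?gt_eqF.
    by rewrite mulr_sumr; apply: eq_bigr => a _; rewrite /v /= mxE.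
  by move/ltW.
have szh k : size (g k).1 = stage m.
  have [[-> _ _] _ _] := gP k; rewrite -stage_parent //; by case/andP: mT.
have [h0 h0f] : exists h0, feasible_hist (parent m) h0 by exists (g 0%N).1; have [] := gP 0%N.
have uE : u = 0.
  apply: (no_recession mT h0f u0); apply/matrixP => r c; rewrite ord1 [RHS]mxE.
  set xi := node_data P m.
  have rowE i (w : 'cV[R]_d) : (tech xi i *m w) r 0 = dotv (row r (tech xi i))^T w.
    by rewrite !mxE; apply: eq_bigr => a _; rewrite !mxE.
  have [D DP] := lform_bound (fun i => (row r (tech xi i))^T) 0 (stage m) C.
  apply/eqP; rewrite -normr_le0; apply/ler_addgt0Pr => e e0; rewrite add0r.
  pose D' := `|rhs xi r 0| + D.
  have e20 : 0 < e / 2 by lra.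
  have [K KP] : exists K : nat, D' / (e / 2) < K%:R.
    exists (Num.truncn (D' / (e / 2))).+1; apply: truncnS_gt.
  have [k [Kk /=]] := near (fun=> (row r (tech xi (stage m)))^T) _ e20 K.
  rewrite /lform !big_nat1 -!rowE => kr.
  have bk : `|(tech xi (stage m) *m (v k)`_0) r 0| <= e / 2.
    rewrite /v /= -scalemxAr mxE normrM ger0_norm ?invr_ge0 ?(ltW (sg0 k)) //.
    rewrite ler_pdivrMl //.
    have -> : (tech xi (stage m) *m (g k).2) r 0 =
        rhs xi r 0 - lform (fun i => (row r (tech xi i))^T) 0 (stage m) (g k).1.
      have [_ [_ +] _] := gP k; rewrite /residual szh => /matrixP/(_ r 0).
      rewrite !mxE summxE /lform (eq_bigr _ (fun i _ => rowE i _)) => E.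
      rewrite -/xi; lra.
    apply: (@le_trans _ _ D').
      apply: le_trans (ler_normB _ _) _; rewrite lerD2l; apply: DP => i a.
      by apply: hC; have [] := gP k.
    apply: ltW; rewrite -ltr_pdivrMr // (lt_trans KP) //.
    by apply: lt_trans (sgk k); rewrite ltr_nat ltnS.
  have := ler_distD ((tech xi (stage m) *m (v k)`_0) r 0) ((tech xi (stage m) *m u) r 0) 0.
  rewrite !subr0 [X in _ <= X + _]distrC => tri.
  by apply: le_trans tri _; move: kr bk; rewrite -/u; lra.
move: su; rewrite uE big1 ?mxE // => [/esym/eqP|a _]; rewrite ?oner_eq0 //.
by rewrite mxE.
Qed.

Lemma hist_bounded n : (stage n <= horizon P)%N ->
  exists C, forall h, feasible_hist n h -> forall i a, `|h`_i a 0| <= C.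
Proof.
have step m : (0 < stage m <= horizon P)%N ->
    (exists C, forall h, feasible_hist (parent m) h -> forall i a, `|h`_i a 0| <= C) ->
    exists C, forall h, feasible_hist m h -> forall i a, `|h`_i a 0| <= C.
  move=> mT [C hC]; have m0 : (0 < stage m)%N by case/andP: mT.
  have [D xD] := extension_bounded mT hC.
  exists (Num.max C D) => h /(feasible_hist_inv m0)[h' [x [-> hf xf]]] i a.
  rewrite nth_rcons le_max; case: ltngtP => [_|_|_].
  - by rewrite hC.
  - by have := hC _ hf (size h') a; rewrite nth_default // => ->.
  - have [x0 _] := xf; rewrite ger0_norm ?x0 //; apply/orP; right.
    apply: le_trans (xD _ _ hf xf); rewrite (bigD1 a) //= ler_wpDr //.
    by apply: sumr_ge0 => b _.
have root : exists C, forall h, feasible_hist None h -> forall i a, `|h`_i a 0| <= C.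
  exists (\sum_a `|x0 P a 0|) => h [sz h0 _] [|i] a.
    rewrite h0 (bigD1 a) //= ler_wpDr //; exact: sumr_ge0.
  by rewrite nth_default ?sz // mxE normr0 sumr_ge0.
case: n => [s|//]; elim: s => [|j s IH] sT; first exact: (@step (Some [::])).
by apply: (@step (Some (j :: s))) => //; apply: IH; exact: ltnW.
Qed.
End Recourse.
End FeasibleHistories.

(** * Recourse functions are bounded and lower semicontinuous *)

Section RecourseFunctions.
Context (R : realType) (d M : nat) (P : mslp R d M).
Implicit Types (n m : node M) (h : hist R d).
Hypothesis Phi_gt0 : forall t j, (2 <= t <= horizon P)%N -> 0 < Phi P t j.
Hypothesis risk : risk_assumptions P.
Hypothesis recourse_ok : bounded_nonempty_recourse P.

Section Risk.
Variable t : nat.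
Hypothesis tT : (2 <= t <= horizon P)%N.

Lemma dens_nonempty : dens P t !=set0.
Proof.
have [[fin _ _ _ _] _ [_ _ dual]] := risk tT.
apply/set0P/eqP => D0; have := fin (fun=> 0).
by rewrite dual D0 image_set0 ereal_sup0.
Qed.

Lemma wmean_le p (Z Z' : 'I_M -> \bar R) e : dens P t p ->
  (forall j, Z' j \is a fin_num) -> (forall j, (Z j <= Z' j + e%:E)%E) ->
  (wmean P t p Z <= wmean P t p Z' + e%:E)%E.
Proof.
move=> Dp Zfin ZZ; have [_ _ [_ sub _]] := risk tT.
have [p0 p1] := sub _ Dp.
have w0 j : 0 <= p 0 j * Phi P t j by rewrite mulr_ge0 // ltW ?Phi_gt0.
have -> : e%:E = (\sum_j (p 0 j * Phi P t j)%:E * e%:E)%E.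
  under eq_bigr do rewrite -EFinM.
  by rewrite sumEFin -mulr_suml p1 mul1r.
rewrite /wmean -big_split /=; apply: lee_sum => j _.
rewrite -muleDr //; last exact: fin_num_adde_defr.
by apply: lee_wpmul2l; rewrite ?lee_fin.
Qed.

Lemma wmean_fin p (Z : 'I_M -> \bar R) :
  (forall j, Z j \is a fin_num) -> wmean P t p Z \is a fin_num.
Proof.
move=> Zfin; rewrite /wmean sum_fin_num; apply/allP => /= x /mapP[j _ ->].
by rewrite fin_numM.
Qed.

Lemma wmean_rho p Z : dens P t p -> (wmean P t p Z <= rho P t Z)%E.
Proof.
move=> Dp; have [_ _ [_ _ ->]] := risk tT.
by apply: ereal_sup_ubound; exists p.
Qed.

(** Densities in the dual representation have total mass 1, so a uniform error
    [e] on the values costs at most [e]. *)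
Lemma rho_le Z Z' e :
  (forall j, Z' j \is a fin_num) -> (forall j, (Z j <= Z' j + e%:E)%E) ->
  (rho P t Z <= rho P t Z' + e%:E)%E.
Proof.
move=> Zfin ZZ; have [_ _ [_ _ dual]] := risk tT.
rewrite {1}dual; apply: ge_ereal_sup => _ [p Dp <-].
by apply: le_trans (wmean_le Dp Zfin ZZ) _; rewrite leeD2r // wmean_rho.
Qed.

Lemma wmean0 p : wmean P t p (fun=> 0%E) = 0%E.
Proof. by rewrite /wmean big1 // => j _; rewrite mule0. Qed.

Lemma rho_bound Z C :
  (forall j, ((- C)%:E <= Z j)%E /\ (Z j <= C%:E)%E) ->
  ((- C)%:E <= rho P t Z)%E /\ (rho P t Z <= C%:E)%E.
Proof.
move=> ZC; have Zfin j : Z j \is a fin_num.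
  have [l u] := ZC j; rewrite fin_numE; apply/andP; split.
    by apply: contraTneq l => ->.
  by apply: contraTneq u => ->.
have [p Dp] := dens_nonempty; split.
  apply: le_trans (wmean_rho _ Dp).
  have : (wmean P t p (fun=> 0%E) <= wmean P t p Z + C%:E)%E.
    apply: wmean_le => // j; have [l _] := ZC j.
    by rewrite -leeBlDr // sub0e -EFinN.
  by rewrite wmean0 -leeBlDr // sub0e -EFinN.
have [_ _ [_ _ ->]] := risk tT; apply: ge_ereal_sup => _ [q Dq <-].
have := @wmean_le q Z (fun=> 0%E) C Dq; rewrite wmean0 add0e; apply=> // j.
by have [_] := ZC j; rewrite ?add0e.
Qed.
End Risk.

Lemma hdot_lform (v : nat -> 'cV[R]_d) h : hdot v h = lform v 1 (size h) h.
Proof. by []. Qed.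

Definition bounded_on n (V : hist R d -> \bar R) C : Prop :=
  forall h, feasible_hist P n h -> ((- C)%:E <= V h)%E /\ (V h <= C%:E)%E.

Definition lsc_on n (V : hist R d -> \bar R) : Prop :=
  forall h, feasible_hist P n h -> forall e, 0 < e -> exists2 del : R, 0 < del &
    forall h', feasible_hist P n h' -> hclose del h h' -> (V h <= V h' + e%:E)%E.

Lemma bounded_on_fin n V C h : bounded_on n V C -> feasible_hist P n h ->
  V h \is a fin_num.
Proof.
move=> bd /bd[l u]; rewrite fin_numE; apply/andP; split.
  by apply: contraTneq l => ->.
by apply: contraTneq u => ->.
Qed.

Lemma stage_value_le m V h x : feasible h (node_data P m) x ->
  (stage_value V h (node_data P m)
     <= (hdot (cost (node_data P m)) (rcons h x))%:E + V (rcons h x))%E.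
Proof. by move=> xf; apply: ereal_inf_lbound; exists x. Qed.

Lemma stage_value_bounded m V C : (1 <= stage m <= horizon P)%N ->
  bounded_on m V C ->
  exists D, bounded_on (parent m) (fun h => stage_value V h (node_data P m)) D.
Proof.
move=> mT VC; have /andP[m0 mT'] := mT.
have [B hB] := hist_bounded recourse_ok mT'.
have [B' hB'] := lform_bound (cost (node_data P m)) 1 (stage m).+1 B.
exists (B' + C) => h hf; split.
  apply: le_ereal_inf_tmp => _ [x xf <-].
  have gf := feasible_hist_rcons m0 hf xf; have [l _] := VC _ gf.
  rewrite opprD EFinD leeD // lee_fin hdot_lform (feasible_hist_size gf).
  by have := hB' _ (hB _ gf); rewrite ler_norml => /andP[].
have [_ [x xf]] := feasible_recourse recourse_ok mT hf.
have gf := feasible_hist_rcons m0 hf xf; have [_ u] := VC _ gf.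
apply: le_trans (stage_value_le V xf) _; rewrite EFinD leeD //.
rewrite lee_fin hdot_lform (feasible_hist_size gf).
by have := hB' _ (hB _ gf); rewrite ler_norml => /andP[].
Qed.

(** Otherwise there are histories converging to [h] with values smaller than
    that of [h] by [e]; their almost optimal decisions cluster at a feasible
    decision for [h], where lower semicontinuity of [V] gives a contradiction. *)
Lemma stage_value_lsc m V C : (1 <= stage m <= horizon P)%N ->
  bounded_on m V C -> lsc_on m V ->
  lsc_on (parent m) (fun h => stage_value V h (node_data P m)).
Proof.
move=> mT VC Vlsc h hf e e0; have /andP[m0 mT'] := mT.
have [D svD] := stage_value_bounded mT VC.
set xi := node_data P m; pose c := cost xi.
have svfin h' : feasible_hist P (parent m) h' -> stage_value V h' xi \is a fin_num.
  exact: bounded_on_fin svD.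
have [B hB] := hist_bounded recourse_ok mT'.
apply: contrapT => nolsc.
have e20 : 0 < e / 2 by lra.
have /choice[v vP] : forall k : nat, exists g, [/\ feasible_hist P m g,
    (forall i a, (i < stage m)%N -> `|h`_i a 0 - g`_i a 0| < k.+1%:R^-1) &
    ((hdot c g)%:E + V g + (e / 2)%:E < stage_value V h xi)%E].
  move=> k; apply: contrapT => nog; apply: nolsc; exists k.+1%:R^-1.
    by rewrite invr_gt0.
  move=> h' hf' close; rewrite leNgt; apply/negP => lt; apply: nog.
  have [_ [x xf <-] xlt] := lb_ereal_inf_adherent e20 (svfin _ hf').
  exists (rcons h' x); split; first exact: feasible_hist_rcons xf.
    move=> i a im; rewrite nth_rcons (feasible_hist_size hf') -stage_parent // im.
    exact: close.
  apply: le_lt_trans lt.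
  have -> : e%:E = ((e / 2)%:E + (e / 2)%:E)%E by rewrite -EFinD -splitr.
  by rewrite addeA leeD2r // ltW.
have vB k : setT k -> [/\ size (v k) = (stage m).+1,
    forall i a, `|(v k)`_i a 0| <= Num.max B 1 & `|(fun=> 0 : R) k| <= Num.max B 1].
  move=> _; have [vf _ _] := vP k; split; first exact: feasible_hist_size vf.
    by move=> i a; rewrite le_max hB.
  by rewrite normr0 le_max ler01 orbT.
have [|g [r0 [sz close]]] := hist_cluster vB; first by move=> K; exists K.
have gf : feasible_hist P m g.
  apply: feasible_hist_closed => // e1 e10; have [k [_ [_ kg _]]] := close _ e10 0%N.
  by exists (v k) => //; have [] := vP k.
have [h' [x [gE hf' xf]]] := feasible_hist_inv m0 gf.
have hh : h' = h.
  apply: (@eq_from_nth _ 0); first by rewrite (feasible_hist_size hf) (feasible_hist_size hf').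
  rewrite (feasible_hist_size hf') -stage_parent // => i im.
  have -> : h'`_i = g`_i by rewrite gE nth_rcons (feasible_hist_size hf') -stage_parent // im.
  apply/matrixP => a c0; rewrite ord1; apply/eqP; rewrite -subr_eq0 -normr_le0.
  apply/ler_addgt0Pr => e1 e10; rewrite add0r.
  have e120 : 0 < e1 / 2 by lra.
  have [k [Kk [_ /(_ i a) kg _]]] := close _ e120 (Num.truncn (e1 / 2)^-1).
  have [_ /(_ i a im) vk _] := vP k.
  have k1 : k.+1%:R^-1 < e1 / 2.
    rewrite invf_plt ?posrE // (lt_le_trans (truncnS_gt _)) //.
    by rewrite ler_nat ltnS.
  apply: le_trans (ler_distD ((v k)`_i a 0) _ _) _.
  have l1 : `|g`_i a 0 - (v k)`_i a 0| < e1 / 2 by rewrite distrC.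
  have l2 : `|(v k)`_i a 0 - h`_i a 0| < e1 / 2.
    by rewrite distrC; exact: lt_trans vk k1.
  by rewrite (splitr e1) ltW // ltrD.

rewrite hh in gE hf'.
have e80 : 0 < e / 8 by lra.
have [d1 d10 VP] := Vlsc _ gf _ e80.
have [d2 d20 cP] := lform_close c 1 (stage m).+1 e80.
have d0 : 0 < Num.min d1 d2 by rewrite lt_min d10.
have [k [_ [_ kg _]]] := close _ d0 0%N.
have [vf _ lt] := vP k.
have k1 : hclose d1 g (v k).
  by move=> i a; rewrite distrC; apply: lt_le_trans (kg i a) _; rewrite ge_min lexx.
have k2 : hclose d2 (v k) g.
  by apply: hclose_le kg; rewrite ge_min lexx orbT.
have := VP _ vf k1; have := cP _ _ k2.
have xf' : feasible h xi x by rewrite -hh.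
have := stage_value_le V xf'; rewrite -gE.
rewrite !hdot_lform sz -/c => le1 cle.
have Vg := bounded_on_fin VC gf; have Vk := bounded_on_fin VC vf.
move: lt le1; rewrite hdot_lform (feasible_hist_size vf).
rewrite -(fineK (svfin _ hf)) -(fineK Vg) -(fineK Vk).
rewrite -!EFinD lte_fin !lee_fin => lt le1 le2.
move: cle; rewrite ltr_distl => /andP[c1 c2]; lra.
Qed.

Lemma recourseE t h : (2 <= t <= horizon P)%N ->
  recourse P t h =
    rho P t (fun j => stage_value (recourse P t.+1) h (supp P t j)).
Proof.
move=> /andP[_ tT]; rewrite /recourse subSS subSn //=.
by rewrite subKn.
Qed.

Lemma recourse_child n t h : (0 < stage n)%N -> t = (stage n).+1 ->
  (t <= horizon P)%N ->
  recourse P t h = rho P t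
    (fun j => stage_value (recourse P t.+1) h (node_data P (child n j))).
Proof.
move=> n0 tn tT; rewrite recourseE; last by rewrite tT tn ltnS n0.
by case: n n0 tn => [s|//] _ ->.
Qed.

Lemma stage_child n j : stage (child n j) = (stage n).+1.
Proof. by case: n. Qed.

Lemma parent_child n j : parent (child n j) = n.
Proof. by case: n. Qed.

Lemma recourse_bounded_lsc n : (1 <= stage n <= horizon P)%N ->
  exists2 C, bounded_on n (recourse P (stage n).+1) C
    & lsc_on n (recourse P (stage n).+1).
Proof.
move: {2}(horizon P - stage n)%N (erefl (horizon P - stage n)%N) => r.
elim: r n => [|r IH] n rE nT.
  have nE : stage n = horizon P.
    by apply/eqP; rewrite eqn_leq -(subn_eq0 (horizon P)) rE eqxx andbT; case/andP: nT.
  have E h : recourse P (stage n).+1 h = 0%E by rewrite nE /recourse subnn.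
  exists 0; first by move=> h _; rewrite E oppr0.
  by move=> h _ e e0; exists 1 => // h' _ _; rewrite !E add0e lee_fin ltW.
have /andP[n0 nT'] := nT.
have lt : (stage n < horizon P)%N by rewrite -subn_gt0 rE.
have tT : (2 <= (stage n).+1 <= horizon P)%N by rewrite lt ltnS n0.
have cT j : (1 <= stage (child n j) <= horizon P)%N by rewrite stage_child lt.
have IHj j : exists2 C, bounded_on (child n j) (recourse P (stage n).+2) C
    & lsc_on (child n j) (recourse P (stage n).+2).
  have := IH (child n j); rewrite stage_child; apply.
    by rewrite subnS rE.
  by rewrite lt.
have /choice[D DP] : forall j, exists D, bounded_on n
    (fun h => stage_value (recourse P (stage n).+2) h (node_data P (child n j))) D.
  move=> j; have [C bd _] := IHj j.
  by have := stage_value_bounded (cT j) bd; rewrite parent_child.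
have DP' j h : feasible_hist P n h ->
    (stage_value (recourse P (stage n).+2) h (node_data P (child n j))) \is a fin_num.
  exact: bounded_on_fin (DP j).
have lsc j : lsc_on n
    (fun h => stage_value (recourse P (stage n).+2) h (node_data P (child n j))).
  have [C bd l] := IHj j.
  by have := stage_value_lsc (cT j) bd l; rewrite parent_child.
exists (\sum_j `|D j|).
  move=> h hf; rewrite (recourse_child _ n0) //; apply: rho_bound => // j.
  have [l u] := DP j h hf.
  have Dj : D j <= \sum_j `|D j|.
    by rewrite (bigD1 j) //= ler_wpDr ?ler_norm // sumr_ge0.
  split; first by apply: le_trans l; rewrite lee_fin lerN2.
  by apply: le_trans u _; rewrite lee_fin.
move=> h hf e e0.
have /choice[f fP] : forall j, exists del, 0 < del /\ forall h', feasible_hist P n h' ->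
    hclose del h h' ->
    (stage_value (recourse P (stage n).+2) h (node_data P (child n j)) <=
     stage_value (recourse P (stage n).+2) h' (node_data P (child n j)) + e%:E)%E.
  by move=> j; have [del ? ?] := lsc j h hf e e0; exists del.
have [del del0 delP] := min_positive f.
exists del => // h' hf' close; rewrite !(recourse_child _ n0) //.
apply: rho_le => // [j|j]; first exact: DP'.
have [f0 H] := fP j; apply: H => //; apply: hclose_le close; exact: delP.
Qed.

End RecourseFunctions.

(** * Cut models and subgradients of the stage problems *)

(** Classical equality on cuts, to speak of membership in a list of cuts. *)
HB.instance Definition _ (R : realType) (d : nat) := gen_eqMixin (ocut R d).

Section Cuts.
Context (R : realType) (d M : nat) (P : mslp R d M).
Implicit Types (n m : node M) (h : hist R d) (xi : stage_data R d)
  (oc : seq (ocut R d)).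

Lemma dotvC (u v : 'cV[R]_d) : dotv u v = dotv v u.
Proof. by apply: eq_bigr => i _; rewrite mulrC. Qed.

Lemma dotv_sumZl (I : finType) (a : I -> R) (b : I -> 'cV[R]_d) w :
  dotv (\sum_l a l *: b l) w = \sum_l a l * dotv (b l) w.
Proof.
rewrite /dotv; under eq_bigr do rewrite summxE mulr_suml.
rewrite exchange_big; apply: eq_bigr => l _; rewrite mulr_sumr.
by apply: eq_bigr => i _; rewrite mxE mulrA.
Qed.

Lemma dotv_sumr q (u : 'cV[R]_q) (r : seq nat) (F : nat -> 'cV[R]_q) :
  dotv u (\sum_(i <- r) F i) = \sum_(i <- r) dotv u (F i).
Proof.
rewrite /dotv; under eq_bigr do rewrite summxE mulr_sumr.
by rewrite exchange_big.
Qed.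

Lemma cut_model_leP oc h (V : \bar R) :
  (cut_model oc h <= V)%E <-> forall c, c \in oc -> (ocut_val c h <= V)%E.
Proof.
rewrite /cut_model; elim: oc => [|c0 oc IH].
  by rewrite big_nil leNye; split.
rewrite big_cons ge_max; split=> [/andP[le0 /IH le] c|le].
  by rewrite inE => /predU1P[->|/le].
rewrite le ?mem_head //=; apply/IH => c coc.
by apply: le; rewrite inE coc orbT.
Qed.

Lemma ocut_val_le_model oc h c : c \in oc -> (ocut_val c h <= cut_model oc h)%E.
Proof. by have /cut_model_leP := lexx (cut_model oc h); apply. Qed.

Lemma cut_model_rcons oc c h :
  (cut_model oc h <= cut_model (rcons oc c) h)%E.
Proof.
apply/cut_model_leP => c' c'oc; apply: ocut_val_le_model.
by rewrite mem_rcons inE c'oc orbT.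
Qed.

Lemma sub_feasibleE h xi oc x z :
  sub_feasible h xi oc [::] (x, z) <->
  feasible h xi x /\ (cut_model oc (rcons h x) <= z%:E)%E.
Proof.
split=> [[/= xf H _]|[xf H]].
  split => //; apply/cut_model_leP => c /(@tnthP _ _ (in_tuple oc))[l ->].
  exact: H.
split => //; last by case.
by move=> l /=; move/cut_model_leP: H; apply; exact: mem_tnth.
Qed.

Lemma stage_value_mono (V V' : hist R d -> \bar R) h xi :
  (forall x, feasible h xi x -> (V (rcons h x) <= V' (rcons h x))%E) ->
  (stage_value V h xi <= stage_value V' h xi)%E.
Proof.
move=> VV; apply: le_ereal_inf_tmp => _ [x xf <-].
apply: (@le_trans _ _ ((hdot (cost xi) (rcons h x))%:E + V (rcons h x))%E).
  by apply: ereal_inf_lbound; exists x.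
by rewrite leeD2l // VV.
Qed.

(** Eliminating the epigraph variable z; a model equal to -oo is matched by
    letting z tend to -oo, and one equal to +oo by the absence of z. *)
Lemma sub_valueE h xi oc :
  sub_value h xi oc [::] = stage_value (cut_model oc) h xi.
Proof.
apply/eqP; rewrite eq_le; apply/andP; split; last first.
  apply: le_ereal_inf_tmp => _ [[x z] /sub_feasibleE[xf le] <-].
  apply: (@le_trans _ _ ((hdot (cost xi) (rcons h x))%:E + cut_model oc (rcons h x))%E).
    by apply: ereal_inf_lbound; exists x.
  by rewrite /sub_cost EFinD leeD2l.
apply: le_ereal_inf_tmp => _ [x xf <-].
have ub z : (cut_model oc (rcons h x) <= z%:E)%E ->
    (sub_value h xi oc [::] <= (hdot (cost xi) (rcons h x) + z)%:E)%E.
  by move=> le; apply: ereal_inf_lbound; exists (x, z) => //; exact/sub_feasibleE.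
case E : (cut_model oc (rcons h x)) ub => [r| |] ub; first by rewrite -EFinD ub.
  by rewrite addey // leey.
rewrite addeNy leeNy_eq; case: (sub_value _ _ _ _) ub => [r| |//] ub.
  have := ub (r - hdot (cost xi) (rcons h x) - 1) (leNye _).
  by rewrite lee_fin; lra.
by have := ub 0 (leNye _); rewrite leye_eq.
Qed.

(** Weak duality: with the multipliers that are optimal at [h], the Lagrangian at
    a point feasible for [h'] is at most the cost there, and it is affine in the
    history with slope [sub_gradient].  A cut with theta = -oo contributes 0 if
    its multiplier is 0; otherwise the Lagrangian is -oo and there is nothing to
    prove. *)
Lemma sub_gradient_le h h' xi oc (mu : multipliers R (nrows xi)) :
  (0 < size h)%N -> size h = size h' -> h`_0 = h'`_0 ->
  sub_multipliers h oc [::] mu ->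
  (sub_value h xi oc [::]
     + (\sum_(1 <= i < size h)
          dotv (sub_gradient oc [::] mu i) (h'`_i - h`_i))%:E
   <= sub_value h' xi oc [::])%E.
Proof.
move=> h0 sz hh0 [mu0 _ infL]; apply: le_ereal_inf_tmp => _ [[x z] uf <-].
have [/= [x0 res0] cuts _] := uf.
set D := \sum_(1 <= i < size h) _.
have le : (sub_value h xi oc [::] <= sub_lagrangian h oc [::] mu (x, z))%E.
  by rewrite -infL; apply: ereal_inf_lbound; exists (x, z).
pose dl (l : 'I_(size oc)) :=
  \sum_(1 <= i < size h) dotv (obeta (tnth (in_tuple oc) l) i) (h'`_i - h`_i).
apply: (@le_trans _ _ (sub_lagrangian h oc [::] mu (x, z) + D%:E)%E).
  by rewrite leeD2r.
rewrite /sub_lagrangian /= big_ord0 addr0.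
have nr (w : hist R d) i : (i < size w)%N -> (rcons w x)`_i = w`_i.
  by move=> iw; rewrite nth_rcons iw.
have ldiff (b : nat -> 'cV[R]_d) :
    \sum_(1 <= i < (size h).+1) dotv (b i) (rcons h x)`_i =
    \sum_(1 <= i < (size h).+1) dotv (b i) (rcons h' x)`_i
    - \sum_(1 <= i < size h) dotv (b i) (h'`_i - h`_i).
  rewrite !big_nat_recr //= !nth_rcons sz ltnn eqxx.
  rewrite [in RHS]addrAC -sumrB; congr (_ + _).
  apply: eq_big_nat => i /andP[_ ih]; rewrite !nr ?sz // dotvB.
  by rewrite opprB addrC subrK.
have term (l : 'I_(size oc)) : ((mu2 mu l)%:E *
     (ocut_val (tnth (in_tuple oc) l) (rcons h x) - z%:E) <=
     (- (mu2 mu l * dl l))%:E)%E.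
  have := cuts l; set c := tnth _ l; rewrite /ocut_val !size_rcons -sz.
  have m0 := mu0 _ (ltn_ord l).
  case: (otheta c) => [th| |] /=; last 2 first.
  - by rewrite addye // leye_eq.
  - move=> _; move: m0; rewrite le_eqVlt => /predU1P[<-|m0].
      by rewrite mul0e mul0r oppr0.
    by rewrite gt0_muleNy ?lte_fin ?leNye.
  rewrite -!EFinD lee_fin => cl; rewrite -?EFinB -?EFinM lee_fin -mulrN ler_wpM2l //.
  set S := \sum_(1 <= i < (size h).+1) _.
  have -> : S = \sum_(1 <= i < (size h).+1)
       dotv (obeta c i) ((rcons h' x)`_i - (oref c)`_i) - dl l.
    rewrite /S /dl -/c !big_nat_recr //= !nth_rcons sz ltnn eqxx.
    rewrite [in RHS]addrAC -sumrB; congr (_ + _).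
    apply: eq_big_nat => i /andP[_ ih]; rewrite !nr ?sz // !dotvB; lra.
  by move: cl; lra.
have sumle : (\sum_(l < size oc) (mu2 mu l)%:E *
     (ocut_val (tnth (in_tuple oc) l) (rcons h x) - z%:E) <=
   (\sum_(l < size oc) - (mu2 mu l * dl l))%:E)%E.
  by rewrite -sumEFin; apply: lee_sum => l _; exact: term.
apply: (le_trans (leeD2r _ (leeD2l _ sumle))).
rewrite -!EFinD lee_fin.
have costE : sub_cost h xi (x, z) = sub_cost h' xi (x, z)
    - \sum_(1 <= i < size h) dotv (cost xi i) (h'`_i - h`_i).
  rewrite /sub_cost /hdot /= !size_rcons -sz ldiff; ring.
have resE : dotv (mu1 mu) (residual h xi x) =
    - \sum_(1 <= i < size h) dotv ((tech xi i)^T *m mu1 mu) (h'`_i - h`_i).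
  have trE i (w : 'cV[R]_d) : dotv (mu1 mu) (tech xi i *m w) =
      dotv ((tech xi i)^T *m mu1 mu) w.
    rewrite /dotv; under eq_bigr do rewrite mxE mulr_sumr.
    rewrite exchange_big /=; apply: eq_bigr => a _.
    rewrite mxE mulr_suml; apply: eq_bigr => b _; rewrite mxE.
    by rewrite mulrA [_ * tech _ _ _ _]mulrC.
  have -> : residual h xi x = residual h xi x - residual h' xi x.
    by rewrite res0 subr0.
  have -> : residual h xi x - residual h' xi x =
      \sum_(1 <= i < size h) (tech xi i *m (h`_i - h'`_i)).
    rewrite /residual -sz !(big_ltn h0) hh0.
    under [RHS]eq_bigr do rewrite mulmxBr.
    rewrite sumrB; set a := \sum_(1 <= i < _) _; set b := \sum_(1 <= i < _) _.
    rewrite opprB !opprD; set u := _ *m _; set v := _ *m x.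
    by apply/matrixP => r c; rewrite !mxE; ring.
  rewrite dotv_sumr -sumrN; apply: eq_bigr => i _.
  by rewrite trE !dotvB opprB.
have DE : D = \sum_(1 <= i < size h) dotv (cost xi i) (h'`_i - h`_i)
   + \sum_(1 <= i < size h) dotv ((tech xi i)^T *m mu1 mu) (h'`_i - h`_i)
   + \sum_(l < size oc) mu2 mu l * dl l.
  have -> : \sum_(l < size oc) mu2 mu l * dl l = \sum_(1 <= i < size h)
      \sum_(l < size oc) mu2 mu l
        * dotv (obeta (tnth (in_tuple oc) l) i) (h'`_i - h`_i).
    by rewrite exchange_big; apply: eq_bigr => l _; rewrite /dl mulr_sumr.
  rewrite /D -!big_split /=; apply: eq_bigr => i _.
  rewrite /sub_gradient big_ord0 addr0 -dotv_sumZl [LHS]dotvC.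
  rewrite (dotvC (cost xi i)) (dotvC (_ *m _)) (dotvC (\sum_(l < _) _)).
  by rewrite -!dotvD.
rewrite costE resE DE sumrN; lra.
Qed.
End Cuts.

(** * Tight cuts at a sequence of points, and validity of cuts *)

Section CatchUp.
Context (R : realType) (d M : nat) (P : mslp R d M).
Hypothesis recourse_ok : bounded_nonempty_recourse P.
Variables (n : node M) (f : hist R d -> R) (C : R).
Hypothesis nT : (stage n <= horizon P)%N.
Hypothesis f_bound : forall h, feasible_hist P n h -> `|f h| <= C.
Variables (x : nat -> hist R d) (th : nat -> R) (be : nat -> nat -> 'cV[R]_d)
  (B : set nat).

Definition cut_at k (h : hist R d) : R :=
  th k + \sum_(1 <= i < (stage n).+1) dotv (be k i) (h`_i - (x k)`_i).

Hypothesis x_feas : forall k, B k -> feasible_hist P n (x k).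
Hypothesis cut_valid : forall k h, B k -> feasible_hist P n h -> cut_at k h <= f h.
Hypothesis cut_tight : forall e, 0 < e ->
  exists K : nat, forall k, (K <= k)%N -> B k -> f (x k) <= th k + e.

(** Suppose the conclusion fails along infinitely many [k], and let [hs], [a] be a
    cluster point of the pairs (x k, f (x k)) over these bad [k].  Pick a bad [l]
    with [x l] very close to [hs]: prolonging the segment from [hs] to [x l] by the
    factor [1 + s1] inside the polytope bounds the increase [q] of cut [l] from
    [hs] to [x l], so cut [l] is still almost [a] at [hs].  Then pick a later bad [k]
    whose [x k] is so close to [hs] that cut [l], whose slope is now fixed, is
    almost [a] there too, contradicting badness of [k]. *)
Lemma cuts_catch_up e : 0 < e -> exists K : nat, forall k, (K <= k)%N -> B k ->
  exists l, [/\ (l < k)%N, B l & f (x k) <= cut_at l (x k) + e].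
Proof.
move=> e0; apply: contrapT => noK.
pose B' := [set k | B k /\ forall l, (l < k)%N -> B l ->
  cut_at l (x k) + e < f (x k)].
have B'inf : frequently B'.
  move=> K; apply: contrapT => nok; apply: noK; exists K => k Kk Bk.
  apply: contrapT => nol; apply: nok; exists k; split => //; split => // l lk Bl.
  by rewrite ltNge; apply/negP => le; apply: nol; exists l.
have [H0 hB] := hist_bounded recourse_ok nT.
have vB k : B' k -> [/\ size (x k) = (stage n).+1,
    forall i a, `|(x k)`_i a 0| <= Num.max H0 C & `|f (x k)| <= Num.max H0 C].
  move=> [Bk _]; have xf := x_feas Bk; split; first exact: feasible_hist_size xf.
    by move=> i a; rewrite le_max (hB _ xf).
  by rewrite le_max f_bound // orbT.
have [hs [a [sz close]]] := hist_cluster vB B'inf.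
have hsf : feasible_hist P n hs.
  apply: feasible_hist_closed => // e1 e10; have [k [_ [[Bk _] kh _]]] := close _ e10 0%N.
  by exists (x k) => //; exact: x_feas.
have [del del0 line] := feasible_hist_prolong hsf.
have C0 : 0 <= C.
  by apply: le_trans (f_bound hsf); exact: normr_ge0.
(* Cut [l] increases by s1 * q from [x l] to the end of the prolonged segment,
   at most 2 * C + e / 8; this choice of s1 gives q <= e / 8. *)
pose s1 := 8 * (2 * C + e) / e.
have s10 : 0 < s1 by rewrite divr_gt0 // mulr_gt0 //; lra.
have e80 : 0 < e / 8 by lra.
have [K0 K0P] := cut_tight e80.
have d0 : 0 < Num.min (e / 8) (del / (1 + s1)).
  by rewrite lt_min e80 divr_gt0 // ltr_wpDr // ltW.
have [l [K0l [B'l lh fl]]] := close _ d0 K0.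
have [Bl _] := B'l.
pose q := lform (be l) 1 (stage n).+1 (x l) - lform (be l) 1 (stage n).+1 hs.
have cutE h : cut_at l h = th l + (lform (be l) 1 (stage n).+1 h
    - lform (be l) 1 (stage n).+1 (x l)).
  by rewrite /cut_at /lform -sumrB; congr (_ + _); apply: eq_bigr => i _; rewrite dotvB.
have szl : size (x l) = size hs by rewrite sz (feasible_hist_size (x_feas Bl)).
have yf : feasible_hist P n (hist_line (1 + s1) (x l) hs).
  apply: line; [by rewrite addr_ge0 // ltW|exact: x_feas|].
  move=> i b; rewrite mulrC -ler_pdivlMr; last by rewrite ltr_wpDr // ltW.
  by apply: ltW; apply: lt_le_trans (lh i b) _; rewrite ge_min lexx orbT.
have := cut_valid Bl yf; rewrite cutE lform_hist_line // => cy.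
have := f_bound yf; rewrite ler_norml => /andP[_ fy].
have := f_bound (x_feas Bl); rewrite ler_norml => /andP[fxl _].
have tl := K0P _ K0l Bl.
have fl' : `|f (x l) - a| < e / 8.
  by apply: lt_le_trans fl _; rewrite ge_min lexx.
have qs : s1 * q <= 2 * C + e / 8 by move: cy; rewrite /q; lra.
have qe : q <= e / 8.
  rewrite -(ler_pM2l s10) (le_trans qs) //.
  have -> : s1 * (e / 8) = 2 * C + e by rewrite /s1; field; rewrite gt_eqF.
  lra.
have [d2 d20 cP] := lform_close (be l) 1 (stage n).+1 e80.
have d3 : 0 < Num.min (e / 8) d2 by rewrite lt_min e80.
have [k [lk [[Bk Hk] kh fk]]] := close _ d3 l.+1.
have fk' : `|f (x k) - a| < e / 8.
  by apply: lt_le_trans fk _; rewrite ge_min lexx.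
have k2 : hclose d2 (x k) hs by apply: hclose_le kh; rewrite ge_min lexx orbT.
have := cP _ _ k2; have := Hk _ lk Bl; rewrite cutE.
move: fk' fl' qe; rewrite /q !ltr_distl => /andP[f1 f2] /andP[f3 f4] qe lt.
by move=> /andP[g1 g2]; lra.
Qed.
End CatchUp.

Section ValidCuts.
Context (R : realType) (d M : nat) (P : mslp R d M).
Implicit Types (n m : node M) (h : hist R d) (oc : seq (ocut R d)).
Hypothesis Phi_gt0 : forall t j, (2 <= t <= horizon P)%N -> 0 < Phi P t j.
Hypothesis risk : risk_assumptions P.
Hypothesis recourse_ok : bounded_nonempty_recourse P.

(** A cut built at one node is used at all nodes of the same stage, hence the
    quantification over nodes. *)
Definition valid_cut (t : nat) (c : ocut R d) : Prop :=
  otheta c != +oo%E /\ forall n h, (stage n).+1 = t -> feasible_hist P n h ->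
    (ocut_val c h <= recourse P t h)%E.

Definition valid_cuts t oc : Prop := forall c, c \in oc -> valid_cut t c.

Lemma valid_cuts_model t oc n h : valid_cuts t oc -> (stage n).+1 = t ->
  feasible_hist P n h -> (cut_model oc h <= recourse P t h)%E.
Proof. by move=> vc tn hf; apply/cut_model_leP => c /vc[_ H]; exact: H tn hf. Qed.

Lemma valid_cuts_rcons t oc c : valid_cuts t oc -> valid_cut t c ->
  valid_cuts t (rcons oc c).
Proof. by move=> vo vc c'; rewrite mem_rcons inE => /predU1P[->|/vo]. Qed.

Lemma cut_model_bounded m oc : (1 <= stage m <= horizon P)%N ->
  valid_cuts (stage m).+1 oc -> ~~ no_cut oc ->
  exists C, bounded_on P m (cut_model oc) C.
Proof.
move=> mT vc /allPn[c coc cfin]; have /andP[_ mT'] := mT.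
have [C VC _] := recourse_bounded_lsc Phi_gt0 risk recourse_ok mT.
have [B hB] := hist_bounded recourse_ok mT'.
have [B' hB'] := lform_bound (obeta c) 1 (stage m).+1 B.
have [ntop _] := vc _ coc.
have [th thE] : exists th, otheta c = th%:E.
  by move: cfin ntop; case: (otheta c) => [r| |]; rewrite ?eqxx //; exists r.
pose r0 := lform (obeta c) 1 (stage m).+1 (oref c).
exists (`|C| + `|th - r0| + `|B'|) => h hf; split; last first.
  apply: le_trans (valid_cuts_model vc (erefl _) hf) _.
  apply: (le_trans (VC _ hf).2); rewrite lee_fin.
  have := ler_norm C; have := normr_ge0 (th - r0); have := normr_ge0 B'; lra.
apply: le_trans (ocut_val_le_model _ coc).
rewrite /ocut_val thE -EFinD lee_fin (feasible_hist_size hf).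
have -> : \sum_(1 <= i < (stage m).+1) dotv (obeta c i) (h`_i - (oref c)`_i) =
    lform (obeta c) 1 (stage m).+1 h - r0.
  by rewrite /r0 /lform -sumrB; apply: eq_bigr => i _; rewrite dotvB.
have := hB' _ (hB _ hf); rewrite ler_norml => /andP[l _].
have := ler_norm B'; have := normr_ge0 C; have := ler_norm (- (th - r0)).
rewrite normrN; lra.
Qed.

Lemma sub_value_fin m oc h : (1 <= stage m <= horizon P)%N ->
  valid_cuts (stage m).+1 oc -> ~~ no_cut oc -> feasible_hist P (parent m) h ->
  sub_value h (node_data P m) oc [::] \is a fin_num.
Proof.
move=> mT vc nc hf; have [C VC] := cut_model_bounded mT vc nc.
have [D bd] := stage_value_bounded recourse_ok mT VC.
by rewrite sub_valueE; exact: (bounded_on_fin bd hf).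
Qed.

Lemma sub_value_le_stage_value m oc h : (0 < stage m)%N ->
  valid_cuts (stage m).+1 oc -> feasible_hist P (parent m) h ->
  (sub_value h (node_data P m) oc [::]
     <= stage_value (recourse P (stage m).+1) h (node_data P m))%E.
Proof.
move=> m0 vc hf; rewrite sub_valueE; apply: stage_value_mono => x xf.
by apply: valid_cuts_model (erefl (stage m).+1) _ => //; exact: feasible_hist_rcons xf.
Qed.

Lemma stage_value_fin m h : (1 <= stage m <= horizon P)%N ->
  feasible_hist P (parent m) h ->
  stage_value (recourse P (stage m).+1) h (node_data P m) \is a fin_num.
Proof.
move=> mT hf; have [C VC _] := recourse_bounded_lsc Phi_gt0 risk recourse_ok mT.
have [D bd] := stage_value_bounded recourse_ok mT VC.
exact: (bounded_on_fin bd hf).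
Qed.

(** The subgradient inequalities of the children average to a lower bound for one
    element of the dual representation of the risk measure.  By interstage
    independence the children of every node of the stage carry the same data. *)
Lemma new_cut_valid n t h oc (p : 'rV[R]_M)
    (mu : forall j, multipliers R (nrows (node_data P (child n j)))) :
  (0 < stage n)%N -> t = (stage n).+1 -> (t <= horizon P)%N -> feasible_hist P n h ->
  valid_cuts t.+1 oc -> ~~ no_cut oc -> dens P t p ->
  (forall j, sub_multipliers h oc [::] (mu j)) ->
  valid_cut t (OCut (wmean P t p (fun j => sub_value h (node_data P (child n j)) oc [::]))
    (fun s => \sum_(j < M) (p 0 j * Phi P t j) *: sub_gradient oc [::] (mu j) s) h).
Proof.
move=> n0 tE tT hf vc nc Dp muP; set v := fun j => _.
have t2 : (2 <= t <= horizon P)%N by rewrite tT tE ltnS n0.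
have cT j : (1 <= stage (child n j) <= horizon P)%N by rewrite stage_child -tE tT tE.
have vc' j : valid_cuts (stage (child n j)).+1 oc by rewrite stage_child -tE.
have hf' j : feasible_hist P (parent (child n j)) h by rewrite parent_child.
have vfin j : v j \is a fin_num by apply: sub_value_fin.
have wfin := wmean_fin P t p vfin.
split => /=; first by move: wfin; rewrite fin_numE => /andP[].
move=> n' h' tn' hf2; have nn : stage n' = stage n by move: tn'; rewrite tE => -[].
have n'0 : (0 < stage n')%N by rewrite nn.
have dataE j : node_data P (child n j) = node_data P (child n' j).
  by move: n0 n'0 nn; case: (n) => [s|//]; case: n' {hf2 tn'} => [s'|//] _ _ [/= ->].
have szE : size h = size h' by rewrite (feasible_hist_size hf) (feasible_hist_size hf2) nn.
pose L j := \sum_(1 <= i < size h) dotv (sub_gradient oc [::] (mu j) i) (h'`_i - h`_i).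
rewrite /ocut_val /= -szE.
have -> : (wmean P t p v + (\sum_(1 <= i < size h)
    dotv (\sum_(j < M) (p 0 j * Phi P t j) *: sub_gradient oc [::] (mu j) i)
      (h'`_i - h`_i))%:E)%E = wmean P t p (fun j => v j + (L j)%:E)%E.
  have -> : \sum_(1 <= i < size h)
      dotv (\sum_(j < M) (p 0 j * Phi P t j) *: sub_gradient oc [::] (mu j) i)
        (h'`_i - h`_i) = \sum_j (p 0 j * Phi P t j) * L j.
    under eq_bigr do rewrite dotv_sumZl.
    by rewrite exchange_big; apply: eq_bigr => j _; rewrite /L mulr_sumr.
  rewrite /wmean -sumEFin -big_split /=; apply: eq_bigr => j _.
  by rewrite /= -(fineK (vfin j)) -?EFinM -?EFinD -?EFinM mulrDr.
rewrite (recourse_child _ n'0) ?tn' //.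
apply: le_trans (wmean_rho risk t2 _ Dp).
pose sv j := stage_value (recourse P t.+1) h' (node_data P (child n' j)).
rewrite -/sv.
have hf2' j : feasible_hist P (parent (child n' j)) h' by rewrite parent_child.
have svfin j : sv j \is a fin_num.
  have := @stage_value_fin (child n' j) h'; rewrite stage_child tn'; apply.
    by rewrite tT tE.
  exact: hf2'.
rewrite -[leRHS]adde0; apply: (wmean_le Phi_gt0 risk t2) => // j; rewrite adde0.
have h0 : (0 < size h)%N by rewrite (feasible_hist_size hf).
have hh : h`_0 = h'`_0 by have [_ -> _] := hf; have [_ -> _] := hf2.
apply: le_trans (sub_gradient_le h0 szE hh (muP j)) _.
rewrite dataE /sv.
have := @sub_value_le_stage_value (child n' j) oc h'; rewrite stage_child tn'.
by apply=> //; rewrite ?tE // -tE.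
Qed.

(** A minimizer for the cut model is feasible for the true stage problem, so the
    error on the value is at most the error of the model at this minimizer. *)
Lemma model_gap m h oc x e : (1 <= stage m <= horizon P)%N ->
  feasible_hist P (parent m) h -> feasible h (node_data P m) x ->
  (sub_value h (node_data P m) oc [::] =
    (hdot (cost (node_data P m)) (rcons h x))%:E + cut_model oc (rcons h x))%E ->
  (recourse P (stage m).+1 (rcons h x) <= cut_model oc (rcons h x) + e%:E)%E ->
  (stage_value (recourse P (stage m).+1) h (node_data P m)
    <= sub_value h (node_data P m) oc [::] + e%:E)%E.
Proof.
move=> mT hf xf -> gap; apply: le_trans (stage_value_le _ xf) _.
by rewrite -addeA leeD2l.
Qed.
End ValidCuts.

(** * The run of the algorithm *)

Section Algorithm.
Context (R : realType) (d M : nat) (P : mslp R d M).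
Implicit Types (n m : node M) (h : hist R d) (oc : nat -> seq (ocut R d)).
Hypothesis Phi_gt0 : forall t j, (2 <= t <= horizon P)%N -> 0 < Phi P t j.
Hypothesis risk : risk_assumptions P.
Hypothesis recourse_ok : bounded_nonempty_recourse P.
Variable S : solvers P.
Hypothesis sol_ok : correct_solvers S.

Local Notation T := (horizon P).

(** The stage problems solved along the path to a node, whether or not the node
    is sampled, from the optimality cuts [oc] and without feasibility cuts. *)
Fixpoint trial_path (k : nat) oc (s : seq 'I_M) : hist R d :=
  let h := if s is _ :: s' then trial_path k oc s' else [:: x0 P] in
  rcons h (sub_sol S k (Some s) h (oc (size s).+2) [::]).

Definition trial_hist (k : nat) oc n : hist R d :=
  if n is Some s then trial_path k oc s else [:: x0 P].

Lemma trial_histE k oc m : (0 < stage m)%N ->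
  trial_hist k oc m = rcons (trial_hist k oc (parent m))
    (sub_sol S k m (trial_hist k oc (parent m)) (oc (stage m).+1) [::]).
Proof. by case: m => [[|j s]|]. Qed.

Lemma size_trial_hist k oc n : size (trial_hist k oc n) = (stage n).+1.
Proof.
by case: n => [s|//] /=; elim: s => [//|j s IH]; rewrite /= size_rcons IH.
Qed.

Lemma stage_scenario (j : nat -> 'I_M) t : stage (scenario_node j t) = t.
Proof. by case: t => //= t; rewrite size_map size_rev size_iota. Qed.

Lemma parent_scenario (j : nat -> 'I_M) t :
  parent (scenario_node j t.+1) = scenario_node j t.
Proof. by case: t => [//|t]; rewrite scenario_nodeS. Qed.

Lemma take_trial_hist k oc (j : nat -> 'I_M) N t : (t <= N)%N ->
  take t.+1 (trial_hist k oc (scenario_node j N)) = trial_hist k oc (scenario_node j t).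
Proof.
elim: N => [|N IH]; first by rewrite leqn0 => /eqP ->.
rewrite leq_eqVlt => /predU1P[->|tN].
  by rewrite take_oversize // size_trial_hist stage_scenario.
rewrite trial_histE ?stage_scenario // parent_scenario -cats1 takel_cat ?IH //.
by rewrite size_trial_hist stage_scenario.
Qed.

(** The second part starts the backward propagation of finite cuts: Q_{T+1} = 0
    is represented exactly from the beginning. *)
Definition valid_state oc : Prop :=
  (forall t, (2 <= t <= T.+1)%N -> valid_cuts P t (oc t)) /\ ~~ no_cut (oc T.+1).

(** As long as the model is -oo the decision is only known to be feasible;
    afterwards the stage problem has a finite value and it is optimal. *)
Lemma sub_sol_ok k m h o : (1 <= stage m <= T)%N ->
  valid_cuts P (stage m).+1 o -> feasible_hist P (parent m) h ->
  let x := sub_sol S k m h o [::] in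
  feasible h (node_data P m) x /\
  (~~ no_cut o -> sub_value h (node_data P m) o [::] =
    (hdot (cost (node_data P m)) (rcons h x))%:E + cut_model o (rcons h x))%E.
Proof.
move=> mT vc hf x; have [_ _ opt nocut _] := sol_ok.
have [nc|nc] := boolP (no_cut o).
  split => //; have [_ [y yf]] := feasible_recourse recourse_ok mT hf.
  have [|z /sub_feasibleE[]//] := nocut k m h o [::] nc.
  exists (y, 0); apply/sub_feasibleE; split => //; apply/cut_model_leP => c.
  by move=> /(allP nc)/eqP co; rewrite /ocut_val co addNye leNye.
have fin := sub_value_fin Phi_gt0 risk recourse_ok mT vc nc hf.
have [[z [/sub_feasibleE[xf cz] zE]] _] := opt k m h o [::] fin.
split => // _; apply/eqP; rewrite eq_le; apply/andP; split.
  by rewrite sub_valueE; apply: ereal_inf_lbound; exists x.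
by rewrite -zE /sub_cost EFinD leeD2l.
Qed.

Lemma trial_hist_feasible k oc n : valid_state oc -> (stage n <= T)%N ->
  feasible_hist P n (trial_hist k oc n).
Proof.
move=> [vc _]; have root : feasible_hist P None [:: x0 P] by split => // s; case: s.
have step m : (0 < stage m <= T)%N -> feasible_hist P (parent m) (trial_hist k oc (parent m)) ->
    feasible_hist P m (trial_hist k oc m).
  move=> mT hf; have /andP[m0 mT'] := mT; rewrite trial_histE //.
  have [|xf _] := @sub_sol_ok k m _ (oc (stage m).+1) mT _ hf.
    by apply: vc; rewrite ltnS m0.
  exact: feasible_hist_rcons.
case: n => [s|//]; elim: s => [|j s IH] sT; first exact: (@step (Some [::])).
by apply: (@step (Some (j :: s))) => //; apply: IH; exact: ltnW.
Qed.

Lemma p1_value_le0 m h : (1 <= stage m <= T)%N -> feasible_hist P (parent m) h ->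
  (p1_value h (node_data P m) [::] <= 0)%E.
Proof.
move=> mT hf; have [_ [x [x0 xf]]] := feasible_recourse recourse_ok mT hf.
apply: ereal_inf_lbound; exists (x, 0, 0); last first.
  by rewrite /p1_cost /= big1 // => i _; rewrite addr0 mxE.
split; [|by rewrite /= addr0 subr0|by case].
by split => //= i; rewrite mxE.
Qed.

Lemma visit_children k n m : m \in visit S k n -> parent m = n.
Proof.
have [vis _ _ _ _] := sol_ok; rewrite (perm_mem (vis k n)).
case: n => [s|] /=; last by rewrite inE => /eqP ->.
by case/mapP => j _ ->.
Qed.

Lemma visit_stage k n m : m \in visit S k n -> stage m = (stage n).+1.
Proof.
have [vis _ _ _ _] := sol_ok; rewrite (perm_mem (vis k n)).
case: n => [s|] /=; last by rewrite inE => /eqP ->.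
by case/mapP => j _ ->.
Qed.

Lemma forward_run k (j : nat -> 'I_M) oc N : valid_state oc -> (N <= T)%N ->
  iter N (forward_step S k j oc) (Forward [:: x0 P] (fun=> [::])) =
  Forward (trial_hist k oc (scenario_node j N)) (fun=> [::]).
Proof.
move=> vs; elim: N => [//|N IH] NT; rewrite iterS IH ?(ltnW NT) //.
rewrite /forward_step size_trial_hist stage_scenario ltnNge NT [_.-1]/=.
rewrite (eq_in_filter (a2 := pred0)) ?filter_pred0.
  by rewrite (trial_histE k oc (m := scenario_node j N.+1)) ?stage_scenario // parent_scenario.
move=> m mv /=; apply/negbTE; rewrite -leNgt; apply: p1_value_le0.
  by rewrite (visit_stage mv) stage_scenario NT.
rewrite (visit_children mv); apply: trial_hist_feasible => //.
by rewrite stage_scenario ltnW.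
Qed.

(** The state reached after T turns no longer changes, so that it does not matter
    which number of turns is selected in [forward_pass]. *)
Lemma forward_passE k (j : nat -> 'I_M) oc : valid_state oc ->
  forward_pass S k j oc (fun=> [::]) =
  Forward (trial_hist k oc (scenario_node j T)) (fun=> [::]).
Proof.
move=> vs; rewrite /forward_pass; set Q := [set N | _].
have QT : Q T by rewrite /Q /= forward_run //= size_trial_hist stage_scenario.
have := @xgetPex _ 0%N Q (ex_intro _ T QT); set N := xget _ _.
have [TN|NT] := leqP T N; last first.
  by rewrite /Q /= forward_run ?(ltnW NT) //= size_trial_hist stage_scenario ltnS leqNgt NT.
move=> _; rewrite -(subnK TN) iterD forward_run //.
elim: (N - T)%N => [//|i IH]; rewrite iterS IH /forward_step.
by rewrite size_trial_hist stage_scenario ltnSn.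
Qed.

(** The optimality cuts after [k] iterations, computed from trial histories;
    [alg_runE] identifies them with those of the algorithm. *)
Fixpoint cuts_after (smp : nat -> nat -> 'I_M) (k : nat) : nat -> seq (ocut R d) :=
  if k is k'.+1 then
    fun t => rcons (cuts_after smp k' t) (new_ocut S k (smp k) (cuts_after smp k') (fun=> [::])
      (trial_hist k (cuts_after smp k') (scenario_node (smp k) T)) t)
  else ocuts (init_state P).

Definition added_cut (smp : nat -> nat -> 'I_M) (k t : nat) : ocut R d :=
  new_ocut S k.+1 (smp k.+1) (cuts_after smp k) (fun=> [::])
    (trial_hist k.+1 (cuts_after smp k) (scenario_node (smp k.+1) T)) t.

Lemma cuts_afterS smp k t :
  cuts_after smp k.+1 t = rcons (cuts_after smp k t) (added_cut smp k t).
Proof. by []. Qed.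

Lemma added_cut_mem smp k l t : (l < k)%N -> added_cut smp l t \in cuts_after smp k t.
Proof.
elim: k => [//|k IH]; rewrite ltnS leq_eqVlt cuts_afterS mem_rcons inE.
by case/predU1P => [->|/IH->]; rewrite ?eqxx ?orbT.
Qed.

Lemma recourse_end h t : (T < t)%N -> recourse P t h = 0%E.
Proof. by rewrite /recourse -subn_eq0 => /eqP ->. Qed.

Lemma zero_cut_val r h : ocut_val (OCut 0%E (fun=> 0 : 'cV[R]_d) r) h = 0%E.
Proof.
rewrite /ocut_val add0e big1 // => i _.
by rewrite /dotv big1 // => a _; rewrite mxE mul0r.
Qed.

Lemma added_cutE smp k t : (1 <= t <= T)%N ->
  let n := scenario_node (smp k.+1) t.-1 in
  let hn := trial_hist k.+1 (cuts_after smp k) n in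
  added_cut smp k t =
    if no_cut (cuts_after smp k t.+1) then OCut -oo%E (fun=> 0) hn else
    let v i := sub_value hn (node_data P (child n i)) (cuts_after smp k t.+1) [::] in
    let p := risk_sol S k.+1 n v in
    OCut (wmean P t p v) (fun s => \sum_(i < M) (p 0 i * Phi P t i) *:
      sub_gradient (cuts_after smp k t.+1) [::]
        (sub_mult S k.+1 (child n i) hn (cuts_after smp k t.+1) [::]) s) hn.
Proof.
move=> /andP[t1 tT] n hn; rewrite /added_cut /new_ocut ltnNge tT /=.
rewrite -/n.
have -> : take t (trial_hist k.+1 (cuts_after smp k)
    (scenario_node (smp k.+1) T)) = hn.
  by rewrite -{1}(prednK t1) take_trial_hist // (leq_trans (leq_pred _)).
by [].
Qed.

Lemma scenario_child_fin smp k t : valid_state (cuts_after smp k) -> (2 <= t <= T)%N ->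
  ~~ no_cut (cuts_after smp k t.+1) ->
  let n := scenario_node (smp k.+1) t.-1 in
  forall i, sub_value (trial_hist k.+1 (cuts_after smp k) n) (node_data P (child n i))
    (cuts_after smp k t.+1) [::] \is a fin_num.
Proof.
move=> vs /andP[t2 tT] nc n i; have t1 : t.-1.+1 = t by rewrite prednK // ltnW.
have nS : (stage n).+1 = t by rewrite stage_scenario.
apply: (sub_value_fin Phi_gt0 risk recourse_ok) => //.
- by rewrite stage_child nS (ltnW t2).
- by rewrite stage_child nS; have [vc _] := vs; apply: vc; rewrite !ltnS tT ltnW.
- by rewrite parent_child; apply: trial_hist_feasible => //; rewrite -ltnS nS ltnW.
Qed.

Lemma scenario_risk_sol smp k t : valid_state (cuts_after smp k) -> (2 <= t <= T)%N ->
  ~~ no_cut (cuts_after smp k t.+1) ->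
  let n := scenario_node (smp k.+1) t.-1 in
  let v i := sub_value (trial_hist k.+1 (cuts_after smp k) n) (node_data P (child n i))
    (cuts_after smp k t.+1) [::] in
  dens P t (risk_sol S k.+1 n v) /\
  forall p, dens P t p -> (wmean P t p v <= wmean P t (risk_sol S k.+1 n v) v)%E.
Proof.
move=> vs tT nc n v; have vfin := scenario_child_fin vs tT nc.
have [_ _ _ _ rs] := sol_ok; have /andP[t2 _] := tT.
have nS : (stage n).+1 = t by rewrite stage_scenario prednK // ltnW.
by have := rs k.+1 n v; rewrite nS; apply.
Qed.

Lemma added_cut_valid smp k t : valid_state (cuts_after smp k) -> (2 <= t <= T.+1)%N ->
  valid_cut P t (added_cut smp k t).
Proof.
move=> vs /andP[t2 tT]; have [tT'|Tt] := leqP t T; last first.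
  rewrite /added_cut /new_ocut Tt; split=> // n h _ _.
  by rewrite zero_cut_val recourse_end.
have t2T : (2 <= t <= T)%N by rewrite t2.
rewrite added_cutE; last by rewrite (ltnW t2).
case: ifPn => nc; first by split => // n h _ _; rewrite /ocut_val /= addNye leNye.
move=> /=; have [Dp _] := scenario_risk_sol vs t2T nc.
have vfin := scenario_child_fin vs t2T nc.
have nS : stage (scenario_node (smp k.+1) t.-1) = t.-1 by rewrite stage_scenario.
have [_ _ opt _ _] := sol_ok; have [vc _] := vs.
apply: (@new_cut_valid _ _ _ _ Phi_gt0 risk recourse_ok) => //.
- by rewrite nS -ltnS prednK // ltnW.
- by rewrite nS prednK // ltnW.
- by apply: trial_hist_feasible => //; rewrite nS (leq_trans (leq_pred _)).
- by apply: vc; rewrite !ltnS tT' ltnW.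
- by move=> i; have [_] := opt k.+1 _ _ _ _ (vfin i).
Qed.

Lemma cuts_after_valid smp k : valid_state (cuts_after smp k).
Proof.
elim: k => [|k IH].
  split=> [t tT c|]; last by rewrite /= ltnSn.
  rewrite /= inE => /eqP ->; case: ifP => [Tt|_].
    by split => // n h _ _; rewrite zero_cut_val recourse_end.
  by split => // n h _ _; rewrite /ocut_val /= addNye leNye.
have [vc nc] := IH; split=> [t tT|].
  by rewrite cuts_afterS; apply: valid_cuts_rcons; [exact: vc|exact: added_cut_valid].
by rewrite cuts_afterS /no_cut all_rcons negb_and nc orbT.
Qed.

(** Finite cuts move backwards by one stage at each iteration. *)
Lemma cuts_after_some_cut smp k t : (2 <= t <= T.+1)%N -> (T < k + t)%N ->
  ~~ no_cut (cuts_after smp k t).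
Proof.
elim: k t => [|k IH] t /andP[t2 tT] kt.
  have -> : t = T.+1 by apply/eqP; rewrite eqn_leq tT.
  by have [] := cuts_after_valid smp 0.
move: tT; rewrite leq_eqVlt => /predU1P[->|tT]; first by have [] := cuts_after_valid smp k.+1.
have nc : ~~ no_cut (cuts_after smp k t.+1).
  by apply: IH; [rewrite !ltnS (ltnW t2)|rewrite addnS].
rewrite cuts_afterS /no_cut all_rcons negb_and added_cutE; last by rewrite (ltnW t2).
rewrite (negbTE nc) /=.
have t2T : (2 <= t <= T)%N by rewrite t2.
have vfin := scenario_child_fin (cuts_after_valid smp k) t2T nc.
set v := fun i => _; set p := risk_sol _ _ _ _.
have := wmean_fin P t p vfin; rewrite fin_numE => /andP[+ _].
by move=> ->.
Qed.

(** Each stage value of a child is underestimated by at most [e], and the risk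
    measure preserves this bound, the density chosen for the cut being the best
    one for the underestimated values. *)
Lemma added_cut_tight smp k t e : (2 <= t <= T)%N ->
  ~~ no_cut (cuts_after smp k t.+1) ->
  let n := scenario_node (smp k.+1) t.-1 in
  let h := trial_hist k.+1 (cuts_after smp k) in
  (forall i, (recourse P t.+1 (h (child n i))
     <= cut_model (cuts_after smp k t.+1) (h (child n i)) + e%:E)%E) ->
  (recourse P t (h n) <= otheta (added_cut smp k t) + e%:E)%E.
Proof.
move=> tT nc n h gap; have vs := cuts_after_valid smp k; have /andP[t2 tT'] := tT.
have nS : (stage n).+1 = t by rewrite stage_scenario prednK // ltnW.
have n0 : (0 < stage n)%N by rewrite -ltnS nS.
have hf : feasible_hist P n (h n) by apply: trial_hist_feasible => //; rewrite -ltnS nS ltnW.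
rewrite added_cutE; last by rewrite (ltnW t2).
rewrite (negbTE nc) /= -/n -/(h n) (recourse_child _ n0) ?nS //.
have [_ best] := scenario_risk_sol vs tT nc.
have vfin := scenario_child_fin vs tT nc.
have [_ _ [_ _ dual]] := risk tT.
rewrite dual; apply: ge_ereal_sup => _ [p Dp <-].
apply: (@le_trans _ _ (wmean P t p (fun i => sub_value (h n)
  (node_data P (child n i)) (cuts_after smp k t.+1) [::]) + e%:E)%E); last first.
  by rewrite leeD2r // best.
apply: (wmean_le Phi_gt0 risk tT Dp) => // i.
have cT : (1 <= stage (child n i) <= T)%N by rewrite stage_child nS tT' ltnW.
have pf : feasible_hist P (parent (child n i)) (h n) by rewrite parent_child.
have vc : valid_cuts P (stage (child n i)).+1 (cuts_after smp k t.+1).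
  by rewrite stage_child nS; have [+ _] := vs; apply; rewrite !ltnS tT' ltnW.
have [xf xopt] := sub_sol_ok k.+1 cT vc pf.
have hE : h (child n i) = rcons (h n)
    (sub_sol S k.+1 (child n i) (h n) (cuts_after smp k t.+1) [::]).
  by rewrite /h trial_histE ?stage_child // parent_child nS.
have := model_gap cT pf xf (xopt nc) (e := e).
rewrite -hE stage_child nS; apply; exact: gap.
Qed.

Definition final_dec smp k : node M -> 'cV[R]_d :=
  if k is k'.+1 then decision S k (smp k) (cuts_after smp k') (fun=> [::])
    (trial_hist k (cuts_after smp k') (scenario_node (smp k) T))
  else fun=> 0.

Lemma alg_runE smp k :
  alg_run S smp k = Running (AlgState (cuts_after smp k) (fun=> [::]) (final_dec smp k)).
Proof.
elim: k => [//|k IH]; rewrite [LHS]/= IH /iteration /=.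
rewrite forward_passE; last exact: cuts_after_valid.
by rewrite size_trial_hist stage_scenario ltnSn.
Qed.

Lemma state_afterE smp k :
  state_after S smp k = AlgState (cuts_after smp k) (fun=> [::]) (final_dec smp k).
Proof. by rewrite /state_after alg_runE. Qed.

Lemma iter_parent_scenario (j : nat -> 'I_M) N r : (r <= N)%N ->
  iter r (@parent M) (scenario_node j N) = scenario_node j (N - r).
Proof.
elim: r => [|r IH] rN; first by rewrite subn0.
have p : (0 < N - r)%N by rewrite subn_gt0.
by rewrite iterS IH ?(ltnW rN) // subnS -{1}(prednK p) parent_scenario.
Qed.

Lemma nth_trial_hist_ancestor k oc n i : (i <= stage n)%N ->
  (trial_hist k oc n)`_i = (trial_hist k oc (iter (stage n - i) (@parent M) n))`_i.
Proof.
move: {2}(stage n) (erefl (stage n)) => N; elim: N n => [|N IH] n nN.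
  by rewrite nN sub0n.
have n0 : (0 < stage n)%N by rewrite nN.
rewrite leq_eqVlt => /predU1P[->|iN]; first by rewrite subnn.
have pE := stage_parent n0; rewrite pE subSn; last by rewrite -ltnS -pE.
rewrite iterSr trial_histE // nth_rcons size_trial_hist -pE iN IH //.
  by move: pE; rewrite nN => -[].
by rewrite -ltnS -pE.
Qed.

Lemma nth_trial_hist_stage k oc m : (0 < stage m)%N ->
  (trial_hist k oc m)`_(stage m) =
    sub_sol S k m (trial_hist k oc (parent m)) (oc (stage m).+1) [::].
Proof.
move=> m0; rewrite [in LHS]trial_histE // nth_rcons size_trial_hist -stage_parent // ltnn.
by rewrite eqxx.
Qed.

(** Proper ancestors of [n] lie on the sampled scenario, where the decisions are
    those of the forward pass; at [n] itself the decision comes either from the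
    forward pass or from the resolution of the siblings, with the same data. *)
Lemma node_histE smp k n : (stage n <= T)%N ->
  scenario_node (smp k.+1) (stage (parent n)) = parent n ->
  node_hist S smp k.+1 n = trial_hist k.+1 (cuts_after smp k) n.
Proof.
move=> nT pn; apply: (@eq_from_nth _ 0).
  by rewrite size_trial_hist !size_map size_iota.
rewrite !size_map size_iota => i; rewrite ltnS => iN.
rewrite /node_hist /lineage -map_comp (nth_map 0%N) ?size_iota // nth_iota // add0n /=.
rewrite nth_trial_hist_ancestor //.
set a := iter _ _ n.
have sa r N m : stage m = N -> (r <= N)%N -> stage (iter r (@parent M) m) = (N - r)%N.
  move=> <-; elim: r => [|r IH] rN; first by rewrite subn0.
  rewrite iterS subnS -IH ?(ltnW rN) //.
  by case: (iter _ _ _) => [[|b s]|].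
have ia : stage a = i by rewrite /a (sa _ _ _ (erefl _)) ?leq_subr // subKn.
case E : a => [s|]; last first.
  have -> : i = 0%N by rewrite -ia E.
  by [].
rewrite -E state_afterE /= /decision ia.
have i0 : (0 < stage a)%N by rewrite E.
have iT : (i <= T)%N := leq_trans iN nT.
case: eqP => [->|ne].
  by rewrite -(take_trial_hist k.+1 (cuts_after smp k) (smp k.+1) iT) nth_take.
have i_eq : i = stage n.
  apply/eqP; rewrite eqn_leq iN leqNgt; apply/negP => lt; apply: ne.
  have n0 : (0 < stage n)%N := leq_ltn_trans (leq0n i) lt.
  have pE := stage_parent n0; have ip : (i <= stage (parent n))%N by rewrite -ltnS -pE.
  rewrite /a pE subSn // iterSr -pn stage_scenario.
  by rewrite iter_parent_scenario ?leq_subr // subKn.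
have an : a = n by rewrite /a i_eq subnn.
rewrite an -[X in _`_X]ia an nth_trial_hist_stage; last by rewrite -an.
have n0 : (0 < stage n)%N by rewrite -an.
have pE := stage_parent n0.
congr (sub_sol S k.+1 n _ _ [::]); last by rewrite i_eq.
rewrite i_eq pE take_trial_hist ?pn //.
by rewrite (leq_trans _ nT) // pE.
Qed.
End Algorithm.

(** * Vanishing gaps and their consequences *)

Section Gaps.
Context (R : realType) (d M : nat) (P : mslp R d M).
Implicit Types (n m : node M) (h : hist R d).
Hypothesis Phi_gt0 : forall t j, (2 <= t <= horizon P)%N -> 0 < Phi P t j.
Hypothesis risk : risk_assumptions P.
Hypothesis recourse_ok : bounded_nonempty_recourse P.
Variable S : solvers P.
Hypothesis sol_ok : correct_solvers S.

Local Notation T := (horizon P).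
Local Notation Q := (recourse P).

Lemma scenario_node_agree (j j' : nat -> 'I_M) t :
  (forall s, (2 <= s <= t)%N -> j s = j' s) -> scenario_node j t = scenario_node j' t.
Proof.
case: t => [//|t] jj; congr Some; apply/eq_in_map => s.
by rewrite mem_rev mem_iota add2n ltnS => /jj.
Qed.

(** Hence the gaps at an iteration are known from the previous samples. *)
Lemma cuts_after_agree (smp smp' : nat -> nat -> 'I_M) k :
  (forall l s, (1 <= l <= k)%N -> (2 <= s <= T)%N -> smp l s = smp' l s) ->
  cuts_after S smp k = cuts_after S smp' k.
Proof.
elim: k => [//|k IH] agr; have E : cuts_after S smp k = cuts_after S smp' k.
  by apply: IH => l s /andP[l1 lk]; apply: agr; rewrite l1 ltnW.
have sE t : (t <= T)%N -> scenario_node (smp k.+1) t = scenario_node (smp' k.+1) t.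
  move=> tT; apply: scenario_node_agree => s /andP[s2 st].
  by apply: agr; rewrite ?ltnSn // s2 (leq_trans st).
apply/funext => t; rewrite !cuts_afterS E /added_cut E sE //.
congr rcons; rewrite /new_ocut; case: ltnP => // tT.
by rewrite sE // (leq_trans (leq_pred _)).
Qed.

(** The trial histories of iteration [k.+1] are compared with the model given by
    the cuts of the first [k] iterations, from which they are computed. *)
Definition gap_le (smp : nat -> nat -> 'I_M) (e : R) k n : Prop :=
  let h := trial_hist S k.+1 (cuts_after S smp k) n in
  (Q (stage n).+1 h <= cut_model (cuts_after S smp k (stage n).+1) h + e%:E)%E.

Lemma gap_le_mono smp e e' k n : e <= e' -> gap_le smp e k n -> gap_le smp e' k n.
Proof. by move=> ee /le_trans; apply; rewrite leeD2l. Qed.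

Lemma gap_last smp e k n : stage n = T -> 0 < e -> gap_le smp e k n.
Proof.
move=> nT e0; rewrite /gap_le nT recourse_end //.
apply: (@le_trans _ _ (cut_model (cuts_after S smp k T.+1)
  (trial_hist S k.+1 (cuts_after S smp k) n))); last first.
  by rewrite leeDl // lee_fin ltW.
have mem : OCut 0%E (fun=> 0) [::] \in cuts_after S smp k T.+1.
  elim: k => [|k IH]; first by rewrite /= ltnSn mem_head.
  by rewrite cuts_afterS mem_rcons inE IH orbT.
rewrite -(zero_cut_val [::] (trial_hist S k.+1 (cuts_after S smp k) n)).
exact: ocut_val_le_model.
Qed.

(** [cuts_catch_up] along the iterations that sample [n], from iteration T on,
    when all cuts are finite. *)
Lemma gap_sampled smp n : (1 <= stage n < T)%N ->
  (forall i e, 0 < e -> exists K, forall k, (K <= k)%N -> gap_le smp e k (child n i)) ->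
  forall e, 0 < e -> exists K, forall k, (K <= k)%N ->
    scenario_node (smp k.+1) (stage n) = n -> gap_le smp e k n.
Proof.
move=> /andP[n0 nT] IH; pose t := (stage n).+1.
have tT : (2 <= t <= T)%N by rewrite /t ltnS n0.
pose B := [set k | (T <= k)%N /\ scenario_node (smp k.+1) (stage n) = n].
pose x k := trial_hist S k.+1 (cuts_after S smp k) n.
pose c k := added_cut S smp k t.
have vs k := cuts_after_valid Phi_gt0 risk recourse_ok sol_ok smp k.
have nT1 : (1 <= stage n <= T)%N by rewrite n0 ltnW.
have [C VC _] := recourse_bounded_lsc Phi_gt0 risk recourse_ok nT1.
have Vfin h : feasible_hist P n h -> Q t h \is a fin_num by exact: bounded_on_fin VC.
pose f h := fine (Q t h).
have fC h : feasible_hist P n h -> `|f h| <= C.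
  move=> hf; have [] := VC h hf; rewrite -(fineK (Vfin h hf)) !lee_fin => l u.
  by rewrite ler_norml l.
have xf k : feasible_hist P n (x k) by apply: trial_hist_feasible => //; exact: ltnW.
have someB k : (T <= k)%N -> ~~ no_cut (cuts_after S smp k t.+1).
  move=> Tk; apply: cuts_after_some_cut => //.
  by rewrite (leq_ltn_trans Tk) // -[ltnLHS]addn0 ltn_add2l.
have cE k : B k -> otheta (c k) \is a fin_num /\ oref (c k) = x k.
  move=> [Tk sn]; rewrite /c added_cutE; last by case/andP: tT => /ltnW ->.
  have vfin := scenario_child_fin Phi_gt0 risk recourse_ok sol_ok (vs k) tT (someB k Tk).
  rewrite (negbTE (someB k Tk)); split; first exact: (wmean_fin P t _ vfin).
  by rewrite /x -[in RHS]sn.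
have cutE k h : B k -> feasible_hist P n h -> ocut_val (c k) h =
    (cut_at n x (fun k => fine (otheta (c k))) (fun k => obeta (c k)) k h)%:E.
  move=> Bk hf; have [cfin cref] := cE k Bk.
  by rewrite /ocut_val /cut_at EFinD fineK // cref (feasible_hist_size hf).
have valid k h : B k -> feasible_hist P n h ->
    cut_at n x (fun k => fine (otheta (c k))) (fun k => obeta (c k)) k h <= f h.
  move=> Bk hf; rewrite -lee_fin -cutE // fineK; last exact: Vfin.
  have [|_] := added_cut_valid Phi_gt0 risk recourse_ok sol_ok (vs k) (t := t).
    by case/andP: tT => -> /leqW.
  by apply.
have tight e : 0 < e -> exists K : nat, forall k, (K <= k)%N -> B k ->
    f (x k) <= fine (otheta (c k)) + e.
  move=> e0; have /choice[K KP] : forall i, exists K, forall k, (K <= k)%N ->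
      gap_le smp e k (child n i) by move=> i; exact: IH.
  exists (\max_i K i)%N => k Kk Bk; have [cfin _] := cE k Bk; have [Tk sn] := Bk.
  rewrite -lee_fin EFinD !fineK //; last exact: Vfin.
  have := @added_cut_tight _ _ _ _ Phi_gt0 risk recourse_ok S sol_ok smp k t e tT (someB k Tk).
  rewrite /= sn; apply=> i.
  have := KP i k (leq_trans (leq_bigmax i) Kk); rewrite /gap_le stage_child.
  exact.
move=> e e0.
have [K KP] := cuts_catch_up recourse_ok (ltnW nT) fC (fun k _ => xf k) valid tight e0.
exists (maxn T K) => k; rewrite geq_max => /andP[Tk Kk] sn.
have [l [lk Bl le]] := KP k Kk (conj Tk sn).
rewrite /gap_le -/t -/(x k) -(fineK (Vfin _ (xf k))) -/(f _).
apply: (@le_trans _ _ (ocut_val (c l) (x k) + e%:E)%E).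
  by rewrite cutE // -EFinD lee_fin.
by rewrite leeD2r //; apply: ocut_val_le_model; exact: added_cut_mem.
Qed.

(** A gap that does not become small would, by recurrence, be large at infinitely
    many iterations that sample [n].  Recurrence is assumed for thresholds 1/(i+1)
    because an almost sure statement can only be combined over countably many. *)
Lemma gaps_vanish smp :
  (forall n i, (stage n <= T)%N ->
    frequently [set k | ~ gap_le smp i.+1%:R^-1 k n] ->
    frequently [set k | ~ gap_le smp i.+1%:R^-1 k n /\
      scenario_node (smp k.+1) (stage n) = n]) ->
  forall n (e : R), (1 <= stage n <= T)%N -> 0 < e ->
    exists K, forall k, (K <= k)%N -> gap_le smp e k n.
Proof.
move=> rec n; move: {2}(T - stage n)%N (erefl (T - stage n)%N) => r.
elim: r n => [|r IH] n rE e nT e0.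
  exists 0%N => k _; apply: gap_last => //.
  by apply/eqP; rewrite eqn_leq -(subn_eq0 T) rE eqxx andbT; case/andP: nT.
have /andP[n0 nT'] := nT.
have lt : (stage n < T)%N by rewrite -subn_gt0 rE.
pose i := Num.truncn e^-1; pose e' : R := i.+1%:R^-1.
have e'0 : 0 < e' by rewrite invr_gt0.
have e'e : e' <= e by rewrite invf_ple ?posrE // ltW // truncnS_gt.
have [||K KP] := @gap_sampled smp n _ _ e' e'0; first by rewrite n0.
  move=> j e1 e10; apply: IH => //; rewrite stage_child ?lt //.
  by rewrite subnS rE.
apply: contrapT => noK.
have [|k [Kk [ng sn]]] := rec n i nT' _ K; last by apply: ng; exact: KP.
move=> L; apply: contrapT => nok; apply: noK; exists L => k Lk.
apply: contrapT => ng; apply: nok; exists k; split => //.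
by apply: contra_not ng; exact: gap_le_mono.
Qed.

Section Convergence.
Variable smp : nat -> nat -> 'I_M.
Hypothesis gaps : forall n (e : R), (1 <= stage n <= T)%N -> 0 < e ->
    exists K, forall k, (K <= k)%N -> gap_le smp e k n.

(** The cut model after iteration [k] dominates the one before it, at which the
    gap is known to vanish. *)
Lemma recourse_model_cvg t n : (2 <= t <= T)%N -> stage n = t.-1 ->
  (fun k => Q t (node_hist S smp k n)
     - recourse_model S smp k t (node_hist S smp k n))%E
    @ within (parent_sampled smp n) \oo --> 0%E.
Proof.
move=> /andP[t2 tT] nt; have tE : t = (stage n).+1 by rewrite nt prednK // ltnW.
have n0 : (0 < stage n)%N by rewrite -ltnS -tE.
have nT : (1 <= stage n <= T)%N by rewrite n0 -ltnS -tE ltnW.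
have [C VC _] := recourse_bounded_lsc Phi_gt0 risk recourse_ok nT.
have vs k := cuts_after_valid Phi_gt0 risk recourse_ok sol_ok smp k.
have key e : 0 < e -> \forall k \near within (parent_sampled smp n) \oo,
    exists2 r : R, 0 <= r <= e & (Q t (node_hist S smp k n)
     - recourse_model S smp k t (node_hist S smp k n))%E = r%:E.
  move=> e0; have [K KP] := gaps nT e0; exists K.+1 => // -[//|k] /= Kk [_ sn].
  rewrite node_histE //; last by case/andP: nT.
  set h := trial_hist _ _ _ _; have hf : feasible_hist P n h.
    by apply: trial_hist_feasible => //; case/andP: nT.
  have up : (recourse_model S smp k.+1 t h <= Q t h)%E.
    rewrite /recourse_model state_afterE //=; apply: (valid_cuts_model _ (esym tE) hf).
    by have [+ _] := vs k.+1; apply; rewrite t2 ltnW.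
  have low : (Q t h <= recourse_model S smp k.+1 t h + e%:E)%E.
    rewrite /recourse_model state_afterE //=.
    have := KP k Kk; rewrite /gap_le -tE -/h => /le_trans; apply.
    by rewrite leeD2r // cut_model_rcons.
  move: up low (bounded_on_fin VC hf); rewrite -tE.
  case: (Q t h) => [q| |] //; case: (recourse_model _ _ _ _ _) => [r| |] //.
  rewrite -EFinD !lee_fin => up low _; exists (q - r); last by rewrite EFinB.
  by rewrite subr_ge0 up; lra.
apply/fine_cvgP; split.
  by apply: filterS (key _ ltr01) => k [r _ ->].
apply/cvgrPdist_le => e e0; apply: filterS (key _ e0) => k [r /andP[r0 re] /= ->].
by rewrite /= sub0r normrN ger0_norm.
Qed.

Local Notation n1 := (Some [::] : node M).
Local Notation hk k := (trial_hist S k.+1 (cuts_after S smp k) n1).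

Hypothesis T_gt0 : (0 < T)%N.

Lemma root_feas : feasible_hist P None [:: x0 P].
Proof. by split => // s; case: s. Qed.

Lemma first_stage_boundE k : (T <= k)%N ->
  feasible [:: x0 P] (xi1 P) (hk k)`_1 /\
  first_stage_bound S smp k =
    ((hdot (cost (xi1 P)) (hk k))%:E + cut_model (cuts_after S smp k 2) (hk k))%E.
Proof.
move=> Tk; have vs := cuts_after_valid Phi_gt0 risk recourse_ok sol_ok smp k.
have vc : valid_cuts P 2 (cuts_after S smp k 2) by have [+ _] := vs; apply.
have nc : ~~ no_cut (cuts_after S smp k 2).
  by apply: cuts_after_some_cut => //; rewrite addn2 ltnS (leq_trans Tk).
have [xf /(_ nc) E] := @sub_sol_ok _ _ _ _ Phi_gt0 risk recourse_ok S sol_ok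
  k.+1 n1 _ _ T_gt0 vc root_feas.
split; first exact: xf.
by rewrite /first_stage_bound !state_afterE.
Qed.

Lemma first_stage_gap e : 0 < e -> exists K, forall k, (K <= k)%N ->
  [/\ (first_stage_bound S smp k <= optimal_value P)%E,
      (optimal_value P <= first_stage_bound S smp k + e%:E)%E
    & ((hdot (cost (xi1 P)) (hk k))%:E + Q 2 (hk k) <= optimal_value P + e%:E)%E].
Proof.
move=> e0; have [K KP] := @gaps n1 e T_gt0 e0.
exists (maxn T K) => k; rewrite geq_max => /andP[Tk Kk].
have vs := cuts_after_valid Phi_gt0 risk recourse_ok sol_ok smp k.
have vc : valid_cuts P 2 (cuts_after S smp k 2) by have [+ _] := vs; apply.
have [xf E] := first_stage_boundE Tk.
have up : (first_stage_bound S smp k <= optimal_value P)%E.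
  rewrite /first_stage_bound !state_afterE //=.
  exact: (@sub_value_le_stage_value _ _ _ _ n1 _ _ isT vc root_feas).
split => //.
  have := KP k Kk; rewrite /gap_le => gap.
  apply: (@le_trans _ _ ((hdot (cost (xi1 P)) (hk k))%:E + Q 2 (hk k))%E).
    exact: (@stage_value_le _ _ _ P n1 (Q 2) _ _ xf).
  by rewrite E -addeA leeD2l.
have := KP k Kk; rewrite /gap_le => gap.
apply: (@le_trans _ _ (first_stage_bound S smp k + e%:E)%E); last by rewrite leeD2r.
by rewrite E -addeA leeD2l.
Qed.

Lemma optimal_value_fin : optimal_value P \is a fin_num.
Proof. exact: (@stage_value_fin _ _ _ _ Phi_gt0 risk recourse_ok n1 _ T_gt0 root_feas). Qed.

Lemma first_stage_bound_cvg : first_stage_bound S smp @ \oo --> optimal_value P.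
Proof.
have ofin := optimal_value_fin.
have key e : 0 < e -> \forall k \near \oo, exists2 r : R,
    `|fine (optimal_value P) - r| <= e & first_stage_bound S smp k = r%:E.
  move=> e0; have [K KP] := first_stage_gap e0; exists K => // k /= Kk.
  have [up low _] := KP k Kk; move: up low; rewrite -(fineK ofin).
  case: (first_stage_bound _ _ _) => [r| |] //; rewrite !lee_fin => up low.
  by exists r => //=; rewrite ler_norml; apply/andP; split; lra.
rewrite -(fineK ofin); apply/fine_cvgP; split.
  by apply: filterS (key _ ltr01) => k [r _ ->].
by apply/cvgrPdist_le => e e0; apply: filterS (key _ e0) => k [r re /= ->].
Qed.

Lemma first_stage_decisionE k : first_stage_decision S smp k.+1 = (hk k)`_1.
Proof. by rewrite -(@node_histE _ _ _ _ Phi_gt0 risk recourse_ok S sol_ok smp k n1 T_gt0). Qed.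

(** Along the decisions the true first stage cost tends to the optimal value, and
    it is lower semicontinuous. *)
Lemma first_stage_cluster x :
  cluster (first_stage_decision S smp @ \oo) x -> first_stage_optimal P x.
Proof.
move=> xcl; pose H := [:: x0 P; x].
have vs k := cuts_after_valid Phi_gt0 risk recourse_ok sol_ok smp k.
have hf k : feasible_hist P n1 (hk k) by exact: trial_hist_feasible.
have close e : 0 < e -> frequently [set k | hclose e (hk k) H].
  move=> e0 K; pose A := [set u | exists k, (K < k)%N /\ u = first_stage_decision S smp k].
  have FA : (first_stage_decision S smp @ \oo) A.
    by exists K.+1 => // k /= Kk; exists k.
  have [_ [[k [Kk ->]] kx]] := xcl A (ball x e) FA (nbhsx_ballx _ _ e0).
  case: k Kk kx => [//|k] Kk; rewrite first_stage_decisionE => kx.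
  exists k; split => // i a; have [sz h0 _] := hf k.
  case: i => [|[|i]]; last by rewrite !nth_default ?sz // mxE subrr normr0.
    by rewrite h0 subrr normr0.
  have [_ kx2] := kx; have := kx2 a 0; rewrite /ball /= distrC; exact.
have Hf : feasible_hist P n1 H.
  apply: feasible_hist_closed => // e e0; have [k [_ kH]] := close e e0 0%N.
  by exists (hk k).
have [h' [x' [E _ xf]]] := @feasible_hist_inv _ _ _ P n1 _ isT Hf.
have {h' x' E xf} xf : feasible [:: x0 P] (xi1 P) x.
  by have [-> ->] := rcons_inj (E : rcons [:: x0 P] x = rcons h' x').
split => //; apply/eqP; rewrite eq_le; apply/andP; split; last first.
  exact: (@stage_value_le _ _ _ P n1 (Q 2) _ _ xf).
have [C VC Vlsc] := @recourse_bounded_lsc _ _ _ _ Phi_gt0 risk recourse_ok n1 T_gt0.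
have ofin := optimal_value_fin.
rewrite -(fineK ofin) -(fineK (bounded_on_fin VC Hf)) -EFinD lee_fin.
apply/ler_addgt0Pr => e e0.
have e30 : 0 < e / 3 by lra.
have [K KP] := first_stage_gap e30.
have [d1 d10 VP] := Vlsc _ Hf _ e30.
have [d2 d20 cP] := lform_close (cost (xi1 P)) 1 2 e30.
have d0 : 0 < Num.min d1 d2 by rewrite lt_min d10.
have [k [Kk kH]] := close _ d0 K.
have k1 : hclose d1 H (hk k).
  by move=> i a; rewrite distrC; apply: lt_le_trans (kH i a) _; rewrite ge_min lexx.
have k2 : hclose d2 (hk k) H by apply: hclose_le kH; rewrite ge_min lexx orbT.
have := VP _ (hf k) k1; have := cP _ _ k2; have [_ _] := KP k Kk.
have hE : hdot (cost (xi1 P)) (hk k) = lform (cost (xi1 P)) 1 2 (hk k) by [].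
have HE : hdot (cost (xi1 P)) H = lform (cost (xi1 P)) 1 2 H by [].
rewrite hE HE -(fineK ofin) -(fineK (bounded_on_fin VC Hf)) -(fineK (bounded_on_fin VC (hf k))).
rewrite -!EFinD !lee_fin /= ltr_distl => a1 /andP[a2 a3] a4; lra.
Qed.

End Convergence.
End Gaps.

(** * Almost sure convergence *)

(** There are countably many pairs of a node and a threshold, so the null sets of
    [sampled_recurrent] add up to a null set. *)
Lemma gaps_recurrent (R : realType) (d M : nat) (P : mslp R d M)
  (dd : measure_display) (Omega : measurableType dd) (Pr : probability Omega R)
  (smp : nat -> nat -> Omega -> 'I_M) (S : solvers P) :
  (forall t j, (2 <= t <= horizon P)%N -> 0 < Phi P t j) ->
  sampling_assumption P Pr smp ->
  {ae Pr, forall w, forall n i, (stage n <= horizon P)%N ->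
    frequently [set k | ~ gap_le S (fun k t => smp k t w) i.+1%:R^-1 k n] ->
    frequently [set k | ~ gap_le S (fun k t => smp k t w) i.+1%:R^-1 k n /\
      scenario_node (fun t => smp k.+1 t w) (stage n) = n]}.
Proof.
move=> Phi_gt0 sampling.
pose run w : nat -> nat -> 'I_M := fun k t => smp k t w.
pose bad n e k : set Omega := [set w | ~ gap_le S (run w) e k n].
pose good (n : node M) i w := (stage n <= horizon P)%N ->
  frequently ((bad n (i.+1%:R^-1))^~ w) ->
  frequently [set k | bad n i.+1%:R^-1 k w /\ sampled smp n k.+1 w].
have ae_good n i : {ae Pr, forall w, good n i w}.
  have [nT|nT] := boolP (stage n <= horizon P)%N; last first.
    by apply: aeW => w nT'; rewrite nT' in nT.
  apply: filterS (sampled_recurrent sampling Phi_gt0 nT (E := bad n i.+1%:R^-1) _).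
    by move=> w H _.
  move=> k w w' a; rewrite /bad /= /gap_le (@cuts_after_agree _ _ _ _ S (run w) (run w')) //.
  move=> l s /andP[l1 lk] sT; apply: a => //.
  by rewrite ltnS lk.
have : {ae Pr, forall w, forall k : nat,
    if unpickle k is Some (n, i) then good n i w else True}.
  apply: ae_foralln => k; case: (unpickle k) => [[n i]|]; first exact: ae_good.
  exact: aeW.
apply: filterS => w H n i.
by have := H (pickle (n, i)); rewrite pickleK.
Qed.

Theorem theorem5p1 (R : realType) (d M : nat) (P : mslp R d M)
  (dd : measure_display) (Omega : measurableType dd) (Pr : probability Omega R)
  (xi : nat -> Omega -> stage_data R d)
  (smp : nat -> nat -> Omega -> 'I_M)
  (sol : solvers P)
  (T_gt0 : (0 < horizon P)%N)
  (xi_fin : finitely_supported P Pr xi)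
  (xi_indep : interstage_independent P Pr xi)
  (risk : risk_assumptions P)
  (recourse_ok : bounded_nonempty_recourse P)
  (sampling : sampling_assumption P Pr smp)
  (sol_ok : correct_solvers sol) :
  let run w : nat -> nat -> 'I_M := fun k t => smp k t w in
  {ae Pr, forall w, exists k, alg_run sol (run w) k = @ReportedInfeasible R d M} \/
  [/\ {ae Pr, forall w, forall k, completed sol (run w) k},
      forall t, (2 <= t <= horizon P)%N ->
        {ae Pr, forall w, forall n : node M, stage n = t.-1 ->
          (fun k => recourse P t (node_hist sol (run w) k n)
                    - recourse_model sol (run w) k t (node_hist sol (run w) k n))%E
            @ within (parent_sampled (run w) n) \oo --> 0%E}
    & {ae Pr, forall w,
        first_stage_bound sol (run w) @ \oo --> optimal_value P /\
        forall x, cluster (first_stage_decision sol (run w) @ \oo) x ->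
          first_stage_optimal P x}].
Proof.
move=> run; right.
have Phi_gt0 t j : (2 <= t <= horizon P)%N -> 0 < Phi P t j.
  by move=> tT; have [_ /(_ t tT)[_ /(_ j)[]]] := xi_fin.
have vanish : {ae Pr, forall w, forall n (e : R), (1 <= stage n <= horizon P)%N ->
    0 < e -> exists K, forall k, (K <= k)%N -> gap_le sol (run w) e k n}.
  apply: filterS (gaps_recurrent sol Phi_gt0 sampling) => w.
  exact: gaps_vanish.
split.
- apply: aeW => w k;
  exists (AlgState (cuts_after sol (run w) k) (fun=> [::])
    (final_dec sol (run w) k)).
  exact: alg_runE.
- move=> t tT; apply: filterS vanish => w gaps n nt.
  exact: recourse_model_cvg.
- apply: filterS vanish => w gaps; split.
    exact: first_stage_bound_cvg.
  exact: first_stage_cluster.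
Qed.
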